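(* Let $N,n,m,L\ge1$ be integers, $\mathbf{A}\in\mathbb{R}^{n\times N}$ a fixed matrix, $\tau,\lambda>0$, and $B_{\mathrm{in}},B_{\mathrm{out}}>0$. Let $\mathbf{x}_1,\dots,\mathbf{x}_m$ be drawn i.i.d. according to some (unknown) probability distribution on $\mathbb{R}^N$ with $\|\mathbf{x}_i\|_2\le B_{\mathrm{in}}$ almost surely, let $\mathbf{y}_i=\mathbf{A}\mathbf{x}_i$, and let $\mathbf{Y}\in\mathbb{R}^{n\times m}$ have columns $\mathbf{y}_1,\dots,\mathbf{y}_m$. Let $\mathcal{H}_2^L$ be the hypothesis space of networks $\mathbf{y}\mapsto\sigma(\mathbf{\Psi}f_{\mathbf{\Phi}}^L(\mathbf{y}))$, $\mathbf{\Psi},\mathbf{\Phi}\in O(N)$. Then for every $\delta\in(0,1)$, with probability at least $1-\delta$ over the samples, for all $h\in\mathcal{H}_2^L$, $$\mathcal{L}(h)\le\hat{\mathcal{L}}(h)+8B_{\mathrm{out}}\sqrt{\frac{Nn}{m}}\sqrt{\log\left(e\left(1+\frac{8K_L\|\mathbf{A}\|_{2\to2}}{\sqrt{m}B_{\mathrm{out}}}\right)\right)}+8B_{\mathrm{out}}\frac{N}{\sqrt{m}}\sqrt{\log\left(e\left(1+\frac{8M_L}{\sqrt{m}B_{\mathrm{out}}}\right)\right)}+4(B_{\mathrm{in}}+B_{\mathrm{out}})\sqrt{\frac{2\log(4/\delta)}{m}}.$$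
   Context: $O(N)$ is the orthogonal group of $N\times N$ real matrices; $\|\cdot\|_{2\to2}$ is the spectral norm and $\|\cdot\|_F$ the Frobenius norm. Soft thresholding: $S_{\mu}(x)=\operatorname{sign}(x)\max(0,|x|-\mu)$ for $x\in\mathbb{R}$, applied entrywise to vectors. Thresholding network: for $\mathbf{\Phi}\in O(N)$ and $\mathbf{y}\in\mathbb{R}^n$, $f_{\mathbf{\Phi}}^1(\mathbf{y})=S_{\tau\lambda}\bigl(\tau(\mathbf{A}\mathbf{\Phi})^\top\mathbf{y}\bigr)$ and, for $l\ge2$, $f_{\mathbf{\Phi}}^l(\mathbf{y})=S_{\tau\lambda}\bigl[(\mathbf{I}-\tau\mathbf{\Phi}^\top\mathbf{A}^\top\mathbf{A}\mathbf{\Phi})f_{\mathbf{\Phi}}^{l-1}(\mathbf{y})+\tau(\mathbf{A}\mathbf{\Phi})^\top\mathbf{y}\bigr]$. The map $\sigma:\mathbb{R}^N\to\mathbb{R}^N$ is $\sigma(\mathbf{x})=\mathbf{x}$ if $\|\mathbf{x}\|_2\le B_{\mathrm{out}}$ and $\sigma(\mathbf{x})=B_{\mathrm{out}}\mathbf{x}/\|\mathbf{x}\|_2$ otherwise. Hypothesis space: $\mathcal{H}_2^L=\{\mathbf{y}\mapsto\sigma(\mathbf{\Psi}f_{\mathbf{\Phi}}^L(\mathbf{y})):\mathbf{\Psi},\mathbf{\Phi}\in O(N)\}$, a set of functions $\mathbb{R}^n\to\mathbb{R}^N$. Loss: $\ell(h,\mathbf{x},\mathbf{y})=\|h(\mathbf{y})-\mathbf{x}\|_2$.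 Empirical loss: $\hat{\mathcal{L}}(h)=\frac1m\sum_{j=1}^m\ell(h,\mathbf{x}_j,\mathbf{y}_j)$. True loss: $\mathcal{L}(h)=\mathbb{E}\,\ell(h,\mathbf{x},\mathbf{y})$, where $\mathbf{x}$ has the sampling distribution and $\mathbf{y}=\mathbf{A}\mathbf{x}$. Constants (depending on the sample through $\mathbf{Y}$), with $a=\|\mathbf{I}-\tau\mathbf{A}^\top\mathbf{A}\|_{2\to2}$ (and $a^0=1$, empty sums equal to $0$): $$K_L=\tau\|\mathbf{Y}\|_F\,a^{L-1}+\tau\|\mathbf{Y}\|_F\sum_{l=2}^{L}a^{L-l}\left(1+2\tau\|\mathbf{A}\|_{2\to2}^2\sum_{k=0}^{l-2}a^k\right),\qquad M_L=\tau\|\mathbf{A}\|_{2\to2}\|\mathbf{Y}\|_F\sum_{k=0}^{L-1}a^k.$$ *)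

(* Defs.v *)
From mathcomp Require Import all_boot all_order all_algebra.
From mathcomp Require Import all_classical all_reals all_analysis.

Set Implicit Arguments.
Unset Strict Implicit.
Unset Printing Implicit Defensive.
Import Order.TTheory GRing.Theory Num.Theory.
Import numFieldTopology.Exports numFieldNormedType.Exports.
Local Open Scope classical_set_scope.
Local Open Scope ring_scope.

Section LinearAlgebra.
Context {R : realType}.

(* The library's norm `|M| on matrices is the max norm. *)
Definition frobenius_norm p q (M : 'M[R]_(p, q)) : R :=
  Num.sqrt (\sum_i \sum_j M i j ^+ 2).

Definition norm2 p (v : 'cV[R]_p) : R := Num.sqrt (\sum_i v i 0 ^+ 2).

Definition spectral_norm p q (M : 'M[R]_(p, q)) : R :=
  sup [set norm2 (M *m v) | v in [set v : 'cV[R]_q | norm2 v <= 1]].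

Definition orthogonal_group p : set 'M[R]_p := [set Q | Q^T *m Q = 1%:M].

End LinearAlgebra.

Section Networks.
Context {R : realType}.

Definition soft_threshold (mu x : R) : R := Num.sg x * Num.max 0 (`|x| - mu).

Definition soft_threshold_vec p (mu : R) (v : 'cV[R]_p) : 'cV[R]_p :=
  map_mx (soft_threshold mu) v.

Definition radial_clip p (Bout : R) (x : 'cV[R]_p) : 'cV[R]_p :=
  if norm2 x <= Bout then x else (Bout / norm2 x) *: x.

(* Layers are numbered from 1; the value at layer 0 is irrelevant. *)
Fixpoint thresholding_network n N (A : 'M[R]_(n, N)) (tau lambda : R)
    (Phi : 'M[R]_N) (l : nat) (y : 'cV[R]_n) : 'cV[R]_N :=
  match l with
  | 0%N => 0
  | 1%N => soft_threshold_vec (tau * lambda) (tau *: ((A *m Phi)^T *m y))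
  | l'.+1 =>
      soft_threshold_vec (tau * lambda)
        ((1%:M - tau *: (Phi^T *m A^T *m A *m Phi))
           *m thresholding_network A tau lambda Phi l' y
         + tau *: ((A *m Phi)^T *m y))
  end.

Definition hypothesis_space n N (A : 'M[R]_(n, N)) (tau lambda Bout : R)
    (L : nat) : set ('cV[R]_n -> 'cV[R]_N) :=
  [set h | exists Psi Phi : 'M[R]_N,
     [/\ orthogonal_group Psi, orthogonal_group Phi &
         h = fun y => radial_clip Bout
                        (Psi *m thresholding_network A tau lambda Phi L y)]].

Definition const_K n N m (A : 'M[R]_(n, N)) (tau : R) (Y : 'M[R]_(n, m))
    (L : nat) : R :=
  let a := spectral_norm (1%:M - tau *: (A^T *m A)) in
  tau * frobenius_norm Y * a ^+ (L - 1)
  + tau * frobenius_norm Y *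
    \sum_(2 <= l < L.+1)
      a ^+ (L - l) *
      (1 + 2 * tau * spectral_norm A ^+ 2 * \sum_(0 <= k < l - 1) a ^+ k).

Definition const_M n N m (A : 'M[R]_(n, N)) (tau : R) (Y : 'M[R]_(n, m))
    (L : nat) : R :=
  let a := spectral_norm (1%:M - tau *: (A^T *m A)) in
  tau * spectral_norm A * frobenius_norm Y * \sum_(0 <= k < L) a ^+ k.

End Networks.

(* R^p with its Borel sigma-algebra. *)
Definition borel_cV (R : realType) (p : nat) :=
  g_sigma_algebraType (@open 'cV[R]_p).

Definition mutually_independent d d' (Om : measurableType d)
    (T : measurableType d') (R : realType) (P : probability Om R)
    (I : finType) (X : I -> {RV P >-> T}) : Prop :=
  forall (J : {set I}) (B : I -> set T), (forall i, measurable (B i)) ->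
    P (\bigcap_(i in [set` J]) (X i @^-1` B i))
    = (\prod_(i in J) P (X i @^-1` B i))%E.

Definition identically_distributed d d' (Om : measurableType d)
    (T : measurableType d') (R : realType) (P : probability Om R)
    (I : Type) (X : I -> {RV P >-> T}) (D : probability T R) : Prop :=
  forall (i : I) (B : set T), measurable B -> distribution P (X i) B = D B.

Section Losses.
Context {R : realType}.

Definition loss n N (h : 'cV[R]_n -> 'cV[R]_N) (x : 'cV[R]_N) (y : 'cV[R]_n)
  : R := norm2 (h y - x).

Definition empirical_loss n N m (A : 'M[R]_(n, N)) (xs : 'I_m -> 'cV[R]_N)
    (h : 'cV[R]_n -> 'cV[R]_N) : R :=
  m%:R^-1 * \sum_(j < m) loss h (xs j) (A *m xs j).

Definition true_loss n N (A : 'M[R]_(n, N))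
    (D : probability (borel_cV R N) R) (h : 'cV[R]_n -> 'cV[R]_N) : \bar R :=
  ('E_D[fun x : borel_cV R N => loss h x (A *m (x : 'cV[R]_N))])%E.

Definition data_matrix n N m (A : 'M[R]_(n, N)) (xs : 'I_m -> 'cV[R]_N)
  : 'M[R]_(n, m) := \matrix_(i, j) (A *m xs j) i 0.

End Losses.

(* Main.v *)
Require Import Defs.
From mathcomp Require Import all_boot all_order all_algebra.
From mathcomp Require Import all_classical all_reals all_analysis.
From mathcomp Require Import measurable_realfun.
From mathcomp Require Import ring lra.
Set Implicit Arguments.
Unset Strict Implicit.
Unset Printing Implicit Defensive.
Import Order.TTheory GRing.Theory Num.Theory.
Import numFieldTopology.Exports numFieldNormedType.Exports.
Local Open Scope classical_set_scope.
Local Open Scope ring_scope.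

(** The difference between the true and the empirical loss is controlled by
    symmetrization, and the resulting Rademacher process by chaining.

    Geometry of the class. The network depends on [Phi] only through the
    [n * N] matrix [A *m Phi]. Layer by layer, its output on an input [y] is
    Lipschitz in [A *m Phi] and bounded, both in proportion to |y|; the two
    factors are those of [const_K] and [const_M]. Soft thresholding and the
    clipping [radial_clip] are nonexpansive, so over a sample the losses of
    two networks are at l2 distance at most
    [const_K * |A Phi - A Phi'| + const_M * |Psi - Psi'|]
    ([network_loss_weight_lipschitz]). No contraction principle for
    vector-valued processes enters, because the loss itself is 1-Lipschitz in
    the output. A ball of radius [r] in a normed space of dimension [d] has an
    [eps]-net of at most [(1 + 2 * r / eps) ^ d] points ([finite_net]). This is
    usually proved by comparing volumes; here packings are multiplied by
    themselves, so that a crude count of lattice cells suffices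
    ([separated_size]). Dyadic chaining ([chaining], [entropy_sum2]) then
    bounds the Rademacher process, for each fixed sample
    ([network_rademacher_bounded]).

    Probability. For samples in a bounded set, the class can be replaced by a
    finite one and the signal space by finitely many Borel cells, each with a
    representative, at the cost of arbitrarily small errors. The cells met by
    the samples are independent with a law on a finite type, so every mean
    becomes a finite sum and measurability of suprema is not an issue. In this
    setting the largest deviation minus twice the empirical Rademacher average
    has a nonpositive mean ([symmetrization]) and bounded differences, hence is
    small with high probability ([mcdiarmid_tail], [uniform_deviation]). The
    deviation term so obtained is smaller than the one claimed, and the
    difference pays for the approximation errors ([confidence_slack]). *)

(** * Euclidean and spectral norms *)

Section EuclideanNorm.
Context {R : realType}.

Definition dot p (u v : 'cV[R]_p) : R := \sum_i u i 0 * v i 0.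

Lemma dotC p (u v : 'cV[R]_p) : dot u v = dot v u.
Proof. by apply: eq_bigr => i _; rewrite mulrC. Qed.

Lemma dotDl p (u v w : 'cV[R]_p) : dot (u + v) w = dot u w + dot v w.
Proof. by rewrite -big_split; apply: eq_bigr => i _; rewrite mxE mulrDl. Qed.

Lemma dotZl p c (u v : 'cV[R]_p) : dot (c *: u) v = c * dot u v.
Proof. by rewrite big_distrr; apply: eq_bigr => i _; rewrite mxE /= mulrA. Qed.

Lemma dotNl p (u v : 'cV[R]_p) : dot (- u) v = - dot u v.
Proof. by rewrite -scaleN1r dotZl mulN1r. Qed.

Lemma dotBl p (u v w : 'cV[R]_p) : dot (u - v) w = dot u w - dot v w.
Proof. by rewrite dotDl dotNl. Qed.

Lemma dotBr p (u v w : 'cV[R]_p) : dot w (u - v) = dot w u - dot w v.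
Proof. by rewrite dotC dotBl dotC (dotC v). Qed.

Lemma dotZr p c (u v : 'cV[R]_p) : dot u (c *: v) = c * dot u v.
Proof. by rewrite dotC dotZl dotC. Qed.

Lemma dot_mulmx p q (M : 'M[R]_(p, q)) u v : dot (M *m u) v = dot u (M^T *m v).
Proof.
rewrite /dot.
under eq_bigr => i _ do rewrite mxE big_distrl /=.
rewrite exchange_big /=; apply: eq_bigr => j _.
rewrite mxE big_distrr /=; apply: eq_bigr => i _.
by rewrite mxE mulrCA mulrA.
Qed.

Lemma norm2E p (v : 'cV[R]_p) : norm2 v ^+ 2 = dot v v.
Proof.
rewrite /norm2 sqr_sqrtr; last by apply: sumr_ge0 => i _; exact: sqr_ge0.
by apply: eq_bigr => i _; rewrite expr2.
Qed.

Lemma norm2_ge0 p (v : 'cV[R]_p) : 0 <= norm2 v.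
Proof. exact: sqrtr_ge0. Qed.

Lemma dot_ge0 p (v : 'cV[R]_p) : 0 <= dot v v.
Proof. by rewrite -norm2E sqr_ge0. Qed.

Lemma norm2Z p c (v : 'cV[R]_p) : norm2 (c *: v) = `|c| * norm2 v.
Proof.
apply: (pexpIrn (n := 2)) => //; rewrite ?nnegrE ?norm2_ge0 ?mulr_ge0//.
  exact: norm2_ge0.
by rewrite exprMn !norm2E dotZl dotZr mulrA -expr2 real_normK ?num_real.
Qed.

Lemma norm20 p : norm2 (0 : 'cV[R]_p) = 0.
Proof. by rewrite -(scale0r 0) norm2Z normr0 mul0r. Qed.

Lemma norm2N p (v : 'cV[R]_p) : norm2 (- v) = norm2 v.
Proof. by rewrite -scaleN1r norm2Z normrN1 mul1r. Qed.

Lemma norm2C p (u v : 'cV[R]_p) : norm2 (u - v) = norm2 (v - u).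
Proof. by rewrite -norm2N opprB. Qed.

Lemma norm2_le p (v : 'cV[R]_p) c : 0 <= c -> dot v v <= c ^+ 2 -> norm2 v <= c.
Proof. by move=> c0 h; rewrite -(@ler_pXn2r _ 2) ?nnegrE ?norm2_ge0// norm2E. Qed.

Lemma entry_le_norm2 p (v : 'cV[R]_p) i : `|v i 0| <= norm2 v.
Proof.
rewrite -(@ler_pXn2r _ 2) ?nnegrE ?norm2_ge0// norm2E real_normK ?num_real//.
rewrite /dot (bigD1 i)//= expr2 lerDl; apply: sumr_ge0 => j _.
by rewrite -expr2 sqr_ge0.
Qed.

Lemma norm2_eq0 p (v : 'cV[R]_p) : norm2 v = 0 -> v = 0.
Proof.
move=> v0; apply/matrixP => i j; rewrite (ord1 j) mxE; apply/eqP.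
by rewrite -normr_eq0 eq_le normr_ge0 andbT -v0 entry_le_norm2.
Qed.

Lemma cauchy_schwarz p (u v : 'cV[R]_p) : dot u v <= norm2 u * norm2 v.
Proof.
have [u0|] := eqVneq (norm2 u) 0.
  by rewrite u0 mul0r (norm2_eq0 u0) -(scale0r 0) dotZl mul0r.
have [v0 _|v0 u0] := eqVneq (norm2 v) 0.
  by rewrite v0 mulr0 (norm2_eq0 v0) -(scale0r 0) dotZr mul0r.
have au : 0 < norm2 u by rewrite lt_def u0 norm2_ge0.
have av : 0 < norm2 v by rewrite lt_def v0 norm2_ge0.
have := dot_ge0 (norm2 v *: u - norm2 u *: v).
rewrite dotBl !dotBr !dotZl !dotZr -!norm2E (dotC v u).
set a := norm2 u in u0 au *; set b := norm2 v in v0 av *; set s := dot u v.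
have -> : b * (b * a ^+ 2) - b * (a * s) - (a * (b * s) - a * (a * b ^+ 2))
   = (a * b) * (2 * (a * b - s)) by ring.
by rewrite pmulr_rge0 ?mulr_gt0// pmulr_rge0// subr_ge0.
Qed.

Lemma norm2D p (u v : 'cV[R]_p) : norm2 (u + v) <= norm2 u + norm2 v.
Proof.
apply: norm2_le; first by rewrite addr_ge0 ?norm2_ge0.
rewrite dotDl !(dotC _ (u + v)) !dotDl -!norm2E (dotC v u).
by have := cauchy_schwarz u v; lra.
Qed.

Lemma norm2B p (u v : 'cV[R]_p) : norm2 (u - v) <= norm2 u + norm2 v.
Proof. by rewrite -(norm2N v); exact: norm2D. Qed.

Lemma norm2_dist p (u v : 'cV[R]_p) : `|norm2 u - norm2 v| <= norm2 (u - v).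
Proof.
have := norm2D (u - v) v; have := norm2D (v - u) u.
by rewrite !subrK (norm2C v) ler_norml; lra.
Qed.

End EuclideanNorm.

Section SpectralNorm.
Context {R : realType}.

Lemma frobenius_norm_ge0 p q (M : 'M[R]_(p, q)) : 0 <= frobenius_norm M.
Proof. exact: sqrtr_ge0. Qed.

Lemma norm2_mulmx_frobenius p q (M : 'M[R]_(p, q)) v :
  norm2 (M *m v) <= frobenius_norm M * norm2 v.
Proof.
have M0 i : 0 <= \sum_j M i j ^+ 2 by apply: sumr_ge0 => j _; exact: sqr_ge0.
apply: norm2_le; first by rewrite mulr_ge0 ?norm2_ge0 ?frobenius_norm_ge0.
rewrite exprMn sqr_sqrtr; last exact: sumr_ge0.
rewrite big_distrl /=; apply: ler_sum => i _.
have rowE : (M *m v) i 0 = dot (row i M)^T v.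
  by rewrite mxE; apply: eq_bigr => j _; rewrite !mxE.
have -> : \sum_j M i j ^+ 2 = norm2 (row i M)^T ^+ 2.
  by rewrite norm2E; apply: eq_bigr => j _; rewrite !mxE expr2.
rewrite -expr2 rowE -exprMn -(@real_normK _ (dot _ _)) ?num_real//.
rewrite lerXn2r ?nnegrE ?mulr_ge0 ?norm2_ge0// ler_norml.
by rewrite cauchy_schwarz lerNl -dotNl -(norm2N (row i M)^T) cauchy_schwarz.
Qed.

Lemma spectral_norm_has_sup p q (M : 'M[R]_(p, q)) :
  has_sup [set norm2 (M *m v) | v in [set v : 'cV[R]_q | norm2 v <= 1]].
Proof.
split; first by exists (norm2 (M *m 0)); exists 0 => //=; rewrite norm20.
exists (frobenius_norm M) => _ [v /= v1 <-].
by rewrite (le_trans (norm2_mulmx_frobenius _ _))// ler_piMr ?frobenius_norm_ge0.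
Qed.

Lemma spectral_norm_ge0 p q (M : 'M[R]_(p, q)) : 0 <= spectral_norm M.
Proof.
apply: le_trans (norm2_ge0 (M *m 0)) _.
by apply: ub_le_sup; [case: (spectral_norm_has_sup M)|exists 0 => //=; rewrite norm20].
Qed.

Lemma norm2_mulmx p q (M : 'M[R]_(p, q)) v :
  norm2 (M *m v) <= spectral_norm M * norm2 v.
Proof.
have [v0|v0] := eqVneq (norm2 v) 0; first by rewrite (norm2_eq0 v0) mulmx0 !norm20 mulr0.
have nv : 0 < norm2 v by rewrite lt_def v0 norm2_ge0.
rewrite -ler_pdivrMr//; apply: ub_le_sup; first by case: (spectral_norm_has_sup M).
exists ((norm2 v)^-1 *: v) => /=.
  by rewrite norm2Z ger0_norm ?invr_ge0 ?norm2_ge0// mulVf.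
by rewrite -scalemxAr norm2Z ger0_norm ?invr_ge0 ?norm2_ge0// mulrC.
Qed.

Lemma spectral_norm_le p q (M : 'M[R]_(p, q)) c : 0 <= c ->
  (forall v, norm2 (M *m v) <= c * norm2 v) -> spectral_norm M <= c.
Proof.
move=> c0 h; apply: ge_sup; first by case: (spectral_norm_has_sup M).
by move=> _ [v /= v1 <-]; rewrite (le_trans (h v))// ler_piMr.
Qed.

Lemma spectral_norm_le_frobenius p q (M : 'M[R]_(p, q)) :
  spectral_norm M <= frobenius_norm M.
Proof.
by apply: spectral_norm_le; [exact: frobenius_norm_ge0|exact: norm2_mulmx_frobenius].
Qed.

Lemma spectral_normD p q (M M' : 'M[R]_(p, q)) :
  spectral_norm (M + M') <= spectral_norm M + spectral_norm M'.
Proof.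
apply: spectral_norm_le; first by rewrite addr_ge0 ?spectral_norm_ge0.
by move=> v; rewrite mulmxDl (le_trans (norm2D _ _))// mulrDl lerD ?norm2_mulmx.
Qed.

Lemma spectral_normZ p q c (M : 'M[R]_(p, q)) :
  spectral_norm (c *: M) = `|c| * spectral_norm M.
Proof.
have le d (M' : 'M[R]_(p, q)) : spectral_norm (d *: M') <= `|d| * spectral_norm M'.
  apply: spectral_norm_le => [|v]; first by rewrite mulr_ge0 ?spectral_norm_ge0.
  by rewrite -scalemxAl norm2Z -mulrA ler_wpM2l// norm2_mulmx.
have [->|c0] := eqVneq c 0.
  by apply/eqP; rewrite eq_le le normr0 mul0r spectral_norm_ge0.
apply/eqP; rewrite eq_le le /= -ler_pdivlMl ?normr_gt0//.
by rewrite -{1}(scalerK c0 M) (le_trans (le _ _))// normfV.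
Qed.

Lemma spectral_normN p q (M : 'M[R]_(p, q)) : spectral_norm (- M) = spectral_norm M.
Proof. by rewrite -scaleN1r spectral_normZ normrN1 mul1r. Qed.

Lemma spectral_normM p q r (M : 'M[R]_(p, q)) (M' : 'M[R]_(q, r)) :
  spectral_norm (M *m M') <= spectral_norm M * spectral_norm M'.
Proof.
apply: spectral_norm_le => [|v]; first by rewrite mulr_ge0 ?spectral_norm_ge0.
rewrite -mulmxA (le_trans (norm2_mulmx _ _))// -mulrA.
by rewrite ler_wpM2l ?spectral_norm_ge0 ?norm2_mulmx.
Qed.

Lemma spectral_norm_trmx p q (M : 'M[R]_(p, q)) :
  spectral_norm M^T <= spectral_norm M.
Proof.
apply: spectral_norm_le => [|v]; first exact: spectral_norm_ge0.
have [->|v0] := eqVneq (norm2 (M^T *m v)) 0.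
  by rewrite mulr_ge0 ?norm2_ge0 ?spectral_norm_ge0.
rewrite -(@ler_pM2l _ (norm2 (M^T *m v))) ?lt_def ?v0 ?norm2_ge0//.
rewrite -expr2 norm2E -dot_mulmx (le_trans (cauchy_schwarz _ _))//.
by rewrite mulrCA mulrA ler_wpM2r ?norm2_ge0 ?norm2_mulmx.
Qed.

Lemma entry_le_spectral_norm p q (M : 'M[R]_(p, q)) i j :
  `|M i j| <= spectral_norm M.
Proof.
have := le_trans (entry_le_norm2 _ i) (norm2_mulmx M (delta_mx j 0)).
rewrite -colE mxE => /le_trans; apply.
rewrite ler_piMr ?spectral_norm_ge0// norm2_le// /dot (bigD1 j)//= big1 => [|k kj].
  by rewrite mxE !eqxx addr0 expr1n mulr1.
by rewrite mxE (negPf kj) mul0r.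
Qed.

Lemma norm2_le_spectral_norm p (v : 'cV[R]_p) : norm2 v <= spectral_norm v.
Proof.
have := norm2_mulmx v 1%:M; rewrite mulmx1 => /le_trans; apply.
rewrite ler_piMr ?spectral_norm_ge0// norm2_le// /dot big_ord_recl big_ord0.
by rewrite mxE eqxx addr0 expr1n mulr1.
Qed.

Lemma spectral_norm_cV p (v : 'cV[R]_p) : spectral_norm v <= norm2 v.
Proof.
apply: (le_trans (spectral_norm_le_frobenius _)).
by rewrite /frobenius_norm /norm2 ler_wsqrtr// ler_sum// => i _; rewrite big_ord1.
Qed.

Lemma orthogonal_trmx p (Q : 'M[R]_p) : orthogonal_group Q -> orthogonal_group Q^T.
Proof. by rewrite /orthogonal_group /= trmxK => /mulmx1C. Qed.

Lemma norm2_orthogonal p (Q : 'M[R]_p) v : orthogonal_group Q ->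
  norm2 (Q *m v) = norm2 v.
Proof.
move=> oQ; apply: (pexpIrn (n := 2)) => //; rewrite ?nnegrE ?norm2_ge0//.
by rewrite !norm2E dot_mulmx mulmxA oQ mul1mx.
Qed.

Lemma spectral_norm_orthogonal p (Q : 'M[R]_p) : orthogonal_group Q ->
  spectral_norm Q <= 1.
Proof. by move=> oQ; apply: spectral_norm_le => // v; rewrite norm2_orthogonal// mul1r. Qed.

End SpectralNorm.
(** * Lipschitz estimates for the networks *)

Section NonexpansiveMaps.
Context {R : realType}.

Lemma soft_threshold_nonexpansive (mu x y : R) : 0 <= mu ->
  `|soft_threshold mu x - soft_threshold mu y| <= `|x - y|.
Proof.
move=> mu0.
have st (z : R) : soft_threshold mu z =
    if mu <= z then z - mu else if z <= - mu then z + mu else 0.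
  rewrite /soft_threshold maxEle; have [z0|z0|->] := ltrgtP z 0.
  - rewrite ltr0_sg// mulN1r ltr0_norm//.
    by repeat case: ifPn; rewrite -?ltNge => *; lra.
  - rewrite gtr0_sg// mul1r gtr0_norm//.
    by repeat case: ifPn; rewrite -?ltNge => *; lra.
  - rewrite sgr0 mul0r.
    by repeat case: ifPn; rewrite -?ltNge => *; lra.
rewrite !st ler_norml.
have := ler_norm (x - y); have := ler_norm (y - x); rewrite (distrC y).
by repeat case: ifPn; rewrite -?ltNge => *; apply/andP; split; lra.
Qed.

Lemma soft_threshold_vec_nonexpansive p (mu : R) (u v : 'cV[R]_p) : 0 <= mu ->
  norm2 (soft_threshold_vec mu u - soft_threshold_vec mu v) <= norm2 (u - v).
Proof.
move=> mu0; rewrite /norm2 ler_wsqrtr// ler_sum// => i _; rewrite !mxE.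
rewrite -[leLHS]real_normK ?num_real// -[leRHS]real_normK ?num_real//.
by rewrite lerXn2r ?nnegrE// soft_threshold_nonexpansive.
Qed.

Lemma soft_threshold_vec0 p (mu : R) : soft_threshold_vec mu (0 : 'cV[R]_p) = 0.
Proof. by apply/matrixP => i j; rewrite !mxE /soft_threshold sgr0 mul0r. Qed.

Lemma norm2_radial_clip p (B : R) (x : 'cV[R]_p) : 0 <= B ->
  norm2 (radial_clip B x) <= B.
Proof.
move=> B0; rewrite /radial_clip; case: ifPn => //; rewrite -ltNge => Bx.
have x0 : 0 < norm2 x by apply: le_lt_trans Bx.
by rewrite norm2Z ger0_norm ?divr_ge0 ?norm2_ge0// divfK// gt_eqF.
Qed.

(** The obtuse angle criterion: [radial_clip B x] is the metric projection of
    [x] onto the ball of radius [B]. *)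
Lemma radial_clip_obtuse p (B : R) (x z : 'cV[R]_p) : 0 <= B -> norm2 z <= B ->
  dot (x - radial_clip B x) (z - radial_clip B x) <= 0.
Proof.
move=> B0 zB; rewrite /radial_clip; case: ifPn => [_|].
  by rewrite subrr -(scale0r 0) dotZl mul0r.
rewrite -ltNge => Bx.
have x0 : 0 < norm2 x by apply: le_lt_trans Bx.
set s := B / norm2 x.
have sx : s * norm2 x = B by rewrite divfK// gt_eqF.
have s1 : s <= 1 by rewrite ler_pdivrMr// mul1r ltW.
rewrite -{1}(scale1r x) -scalerBl dotZl dotBr dotZr -norm2E.
have -> : s * norm2 x ^+ 2 = norm2 x * B by rewrite expr2 mulrA sx mulrC.
rewrite mulr_ge0_le0 ?subr_ge0// subr_le0 (le_trans (cauchy_schwarz _ _))//.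
by rewrite ler_wpM2l ?norm2_ge0.
Qed.

Lemma radial_clip_nonexpansive p (B : R) (x y : 'cV[R]_p) : 0 <= B ->
  norm2 (radial_clip B x - radial_clip B y) <= norm2 (x - y).
Proof.
move=> B0; set u := radial_clip B x; set v := radial_clip B y.
have xu : dot (x - u) (v - u) <= 0 by rewrite radial_clip_obtuse ?norm2_radial_clip.
have yv : dot (y - v) (u - v) <= 0 by rewrite radial_clip_obtuse ?norm2_radial_clip.
have [->|uv0] := eqVneq (norm2 (u - v)) 0; first exact: norm2_ge0.
rewrite -(@ler_pM2r _ (norm2 (u - v))) ?lt_def ?uv0 ?norm2_ge0//.
rewrite (le_trans _ (cauchy_schwarz _ _))// -expr2 norm2E.
move: xu yv; rewrite !dotBl !dotBr; lra.
Qed.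

End NonexpansiveMaps.

Section NetworkEstimates.
Context {R : realType}.
Variables (n N : nat) (A : 'M[R]_(n, N)) (tau lambda : R).
Hypotheses (tau_gt0 : 0 < tau) (lambda_gt0 : 0 < lambda).

Let a : R := spectral_norm (1%:M - tau *: (A^T *m A)).
Let nA : R := spectral_norm A.
Let thr_ge0 : 0 <= tau * lambda. Proof. by rewrite mulr_ge0 ?ltW. Qed.

Let a_ge0 : 0 <= a. Proof. exact: spectral_norm_ge0. Qed.
Let nA_ge0 : 0 <= nA. Proof. exact: spectral_norm_ge0. Qed.

(** The factor of [frobenius_norm Y] in [const_M]: a Lipschitz constant of the
    network with respect to its input. *)
Definition input_gain (l : nat) : R := tau * nA * \sum_(0 <= k < l) a ^+ k.

(** The factor of [frobenius_norm Y] in [const_K]: the sensitivity of the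
    network with respect to its weights [A *m Phi], for inputs of norm 1. *)
Definition weight_gain (l : nat) : R :=
  tau * a ^+ (l - 1) + tau * \sum_(2 <= j < l.+1)
    a ^+ (l - j) * (1 + 2 * tau * nA ^+ 2 * \sum_(0 <= k < j - 1) a ^+ k).

Lemma const_ME m (Y : 'M[R]_(n, m)) l :
  const_M A tau Y l = input_gain l * frobenius_norm Y.
Proof. by rewrite /const_M /input_gain -/a -/nA; ring. Qed.

Lemma const_KE m (Y : 'M[R]_(n, m)) l :
  const_K A tau Y l = weight_gain l * frobenius_norm Y.
Proof. by rewrite /const_K /weight_gain -/a -/nA; ring. Qed.

Lemma geometric_ge0 l : 0 <= \sum_(0 <= k < l) a ^+ k.
Proof. by apply: sumr_ge0 => k _; rewrite exprn_ge0. Qed.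

Lemma input_gain_ge0 l : 0 <= input_gain l.
Proof. by rewrite mulr_ge0 ?geometric_ge0// mulr_ge0// ltW. Qed.

Lemma weight_gain_ge0 l : 0 <= weight_gain l.
Proof.
rewrite addr_ge0// mulr_ge0 ?exprn_ge0 ?(ltW tau_gt0)//; apply: sumr_ge0 => j _.
rewrite mulr_ge0 ?exprn_ge0// addr_ge0// mulr_ge0 ?geometric_ge0//.
by rewrite !mulr_ge0 ?sqr_ge0// ltW.
Qed.

Lemma input_gainS l : input_gain l.+1 = a * input_gain l + tau * nA.
Proof.
rewrite /input_gain big_nat_recl// expr0.
under eq_bigr => k _ do rewrite exprS.
rewrite -mulr_sumr; ring.
Qed.

Lemma weight_gainS l : (1 <= l)%N -> weight_gain l.+1 =
  a * weight_gain l + tau * (1 + 2 * nA * input_gain l).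
Proof.
move=> l1; rewrite /weight_gain big_nat_recr//= subnn expr0 subn1 /=.
have -> : a ^+ l = a * a ^+ (l - 1) by rewrite -exprS subn1 prednK.
rewrite (@eq_big_nat _ _ _ 2 l.+1 _ (fun j => a * (a ^+ (l - j) *
    (1 + 2 * tau * nA ^+ 2 * \sum_(0 <= k < j - 1) a ^+ k)))); last first.
  by move=> j /andP[_ jl]; rewrite subSn// exprS mulrA.
by rewrite -mulr_sumr /input_gain; ring.
Qed.

Lemma thresholding_networkS Phi l y : (1 <= l)%N ->
  thresholding_network A tau lambda Phi l.+1 y =
  soft_threshold_vec (tau * lambda)
    ((1%:M - tau *: (Phi^T *m A^T *m A *m Phi))
       *m thresholding_network A tau lambda Phi l y
     + tau *: ((A *m Phi)^T *m y)).
Proof. by case: l. Qed.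

Lemma spectral_norm_weights Phi : orthogonal_group Phi ->
  spectral_norm (A *m Phi) <= nA.
Proof.
move=> oPhi; rewrite (le_trans (spectral_normM _ _))// ler_piMr//.
exact: spectral_norm_orthogonal.
Qed.

Lemma norm2_tr_weights Phi y : orthogonal_group Phi ->
  norm2 ((A *m Phi)^T *m y) <= nA * norm2 y.
Proof.
move=> oPhi; rewrite (le_trans (norm2_mulmx _ _))// ler_wpM2r ?norm2_ge0//.
by rewrite (le_trans (spectral_norm_trmx _))// spectral_norm_weights.
Qed.

(** Conjugating by [Phi] turns the layer matrix into [1 - tau A^T A]. *)
Lemma norm2_layer Phi v : orthogonal_group Phi ->
  norm2 ((1%:M - tau *: (Phi^T *m A^T *m A *m Phi)) *m v) <= a * norm2 v.
Proof.
move=> oPhi.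
have -> : 1%:M - tau *: (Phi^T *m A^T *m A *m Phi) =
    Phi^T *m (1%:M - tau *: (A^T *m A)) *m Phi.
  rewrite mulmxBr mulmxBl mulmx1 oPhi; congr (_ - _).
  by rewrite -scalemxAr -scalemxAl !mulmxA.
rewrite -!mulmxA (norm2_orthogonal _ (orthogonal_trmx oPhi)).
by rewrite (le_trans (norm2_mulmx _ _))// norm2_orthogonal.
Qed.

Lemma network_input_lipschitz Phi l y y' : orthogonal_group Phi ->
  norm2 (thresholding_network A tau lambda Phi l y
         - thresholding_network A tau lambda Phi l y')
  <= input_gain l * norm2 (y - y').
Proof.
move=> oPhi; elim: l => [|[_|l IHl]].
- by rewrite /= subrr norm20; apply: mulr_ge0; [exact: input_gain_ge0|exact: norm2_ge0].
- rewrite /= (le_trans (soft_threshold_vec_nonexpansive _ _ _))//.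
  rewrite -scalerBr -mulmxBr norm2Z gtr0_norm// /input_gain big_nat1 expr0 mulr1.
  by rewrite -mulrA ler_pM2l// norm2_tr_weights.
rewrite !(@thresholding_networkS _ l.+1)//.
rewrite (le_trans (soft_threshold_vec_nonexpansive _ _ _))//.
rewrite opprD addrACA -mulmxBr -scalerBr -mulmxBr (le_trans (norm2D _ _))//.
rewrite input_gainS mulrDl norm2Z gtr0_norm// lerD//.
  by rewrite (le_trans (norm2_layer _ oPhi))// -mulrA ler_wpM2l.
by rewrite -mulrA ler_pM2l// norm2_tr_weights.
Qed.

Lemma network0 Phi l : thresholding_network A tau lambda Phi l 0 = 0.
Proof.
elim: l => [|[_|l IHl]] //; first by rewrite /= mulmx0 scaler0 soft_threshold_vec0.
by rewrite thresholding_networkS// IHl !mulmx0 scaler0 addr0 soft_threshold_vec0.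
Qed.

Lemma norm2_network Phi l y : orthogonal_group Phi ->
  norm2 (thresholding_network A tau lambda Phi l y) <= input_gain l * norm2 y.
Proof.
by move=> oPhi; have := network_input_lipschitz l y 0 oPhi; rewrite network0 !subr0.
Qed.

(** In each layer the two networks differ through their layer matrices, whose
    difference is that of the Gram matrices of the weights, and through their
    inputs; the recursion [weight_gainS] adds the two effects. *)
Lemma network_weight_lipschitz Phi Phi' l y : (1 <= l)%N ->
  orthogonal_group Phi -> orthogonal_group Phi' ->
  norm2 (thresholding_network A tau lambda Phi l y
         - thresholding_network A tau lambda Phi' l y)
  <= weight_gain l * spectral_norm (A *m Phi - A *m Phi') * norm2 y.
Proof.
move=> + oP oP'; set B := A *m Phi; set B' := A *m Phi'; set e := spectral_norm _.
have e0 : 0 <= e by exact: spectral_norm_ge0.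
have etr : spectral_norm (B - B')^T <= e by exact: spectral_norm_trmx.
have BE v : norm2 ((B - B')^T *m v) <= e * norm2 v.
  by rewrite (le_trans (norm2_mulmx _ _))// ler_wpM2r ?norm2_ge0.
case: l => [//|l _]; elim: l => [|l IHl].
  rewrite /= (le_trans (soft_threshold_vec_nonexpansive _ _ _))//.
  rewrite -scalerBr -mulmxBl -linearB /= norm2Z gtr0_norm// /weight_gain.
  by rewrite big_geq// subnn expr0 mulr0 addr0 mulr1 -mulrA ler_pM2l.
rewrite !(@thresholding_networkS _ l.+1)//.
rewrite (le_trans (soft_threshold_vec_nonexpansive _ _ _))//.
set f := thresholding_network _ _ _ Phi l.+1 y in IHl *.
set f' := thresholding_network _ _ _ Phi' l.+1 y in IHl *.
(* The difference of the layer matrices is split so that the common factor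
   meets the difference of the outputs, and the Gram difference meets [f']. *)
have -> : (1%:M - tau *: (Phi^T *m A^T *m A *m Phi)) *m f + tau *: (B^T *m y)
     - ((1%:M - tau *: (Phi'^T *m A^T *m A *m Phi')) *m f' + tau *: (B'^T *m y))
   = (1%:M - tau *: (Phi^T *m A^T *m A *m Phi)) *m (f - f')
     + tau *: ((B - B')^T *m y - (B^T *m ((B - B') *m f') + (B - B')^T *m (B' *m f'))).
  have gram Q : Q^T *m A^T *m A *m Q = (A *m Q)^T *m (A *m Q).
    by rewrite trmx_mul !mulmxA.
  have trB : (B - B')^T = B^T - B'^T by exact: linearB.
  rewrite !gram -/B -/B' trB !mulmxBl !mulmxBr !mul1mx.
  rewrite -!scalemxAl !mulmxA.
  move: (B^T *m y) (B'^T *m y) (B^T *m A *m Phi *m f) (B^T *m A *m Phi *m f').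
  move: (B^T *m A *m Phi' *m f') (B'^T *m A *m Phi' *m f') => x1 x2 x3 x4 x5 x6.
  by apply/matrixP => i j; rewrite !mxE; ring.
rewrite (le_trans (norm2D _ _))// norm2Z gtr0_norm// weight_gainS//.
have f'y : norm2 f' <= input_gain l.+1 * norm2 y by exact: norm2_network.
have g0 := input_gain_ge0 l.+1; have y0 := norm2_ge0 y.
have cross1 : norm2 (B^T *m ((B - B') *m f')) <= nA * (e * (input_gain l.+1 * norm2 y)).
  rewrite (le_trans (norm2_tr_weights _ _))// ler_wpM2l//.
  by rewrite (le_trans (norm2_mulmx _ _))// ler_wpM2l.
have cross2 : norm2 ((B - B')^T *m (B' *m f')) <= e * (nA * (input_gain l.+1 * norm2 y)).
  rewrite (le_trans (BE _))// ler_wpM2l// (le_trans (norm2_mulmx _ _))//.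
  by rewrite ler_pM ?norm2_ge0 ?spectral_norm_ge0 ?spectral_norm_weights.
have lay := le_trans (norm2_layer (f - f') oP) (ler_wpM2l a_ge0 IHl).
have rest : tau * norm2 ((B - B')^T *m y -
      (B^T *m ((B - B') *m f') + (B - B')^T *m (B' *m f'))) <=
    tau * (e * norm2 y + (nA * (e * (input_gain l.+1 * norm2 y)) +
             e * (nA * (input_gain l.+1 * norm2 y)))).
  rewrite ler_pM2l// (le_trans (norm2B _ _))// lerD ?BE//.
  by rewrite (le_trans (norm2D _ _))// lerD.
apply: (le_trans (lerD lay rest)); rewrite le_eqVlt; apply/orP; left; apply/eqP.
ring.
Qed.

Variables (Bout : R) (L : nat).
Hypotheses (Bout_gt0 : 0 < Bout) (L_gt0 : (1 <= L)%N).

(** The loss of the network with [Psi = theta.2], [Phi = theta.1] as a function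
    of the signal alone, the measurement being [A *m x]. *)
Definition network_loss (theta : 'M[R]_N * 'M[R]_N) (x : 'cV[R]_N) : R :=
  loss (fun y => radial_clip Bout
                   (theta.2 *m thresholding_network A tau lambda theta.1 L y))
       x (A *m x).

Definition orthogonal_pair (theta : 'M[R]_N * 'M[R]_N) : Prop :=
  orthogonal_group theta.1 /\ orthogonal_group theta.2.

Lemma network_loss_ge0 theta x : 0 <= network_loss theta x.
Proof. exact: norm2_ge0. Qed.

Lemma network_loss_near_norm2 theta x : `|network_loss theta x - norm2 x| <= Bout.
Proof.
rewrite /network_loss /loss -(norm2N x) (le_trans (norm2_dist _ _))//.
by rewrite opprK subrK norm2_radial_clip// ltW.
Qed.

Lemma network_loss_le theta x : network_loss theta x <= norm2 x + Bout.
Proof. by have := network_loss_near_norm2 theta x; rewrite ler_norml; lra. Qed.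

Lemma network_loss_weight_lipschitz theta theta' x :
  orthogonal_pair theta -> orthogonal_pair theta' ->
  `|network_loss theta x - network_loss theta' x| <=
  (weight_gain L * spectral_norm (A *m theta.1 - A *m theta'.1)
   + input_gain L * spectral_norm (theta.2 - theta'.2)) * norm2 (A *m x).
Proof.
case: theta theta' => [P1 Q1] [P2 Q2] [/= oP1 oQ1] [/= oP2 oQ2].
rewrite (le_trans (norm2_dist _ _))// opprB addrA subrK.
rewrite (le_trans (radial_clip_nonexpansive _ _ (ltW Bout_gt0)))//=.
set f := thresholding_network _ _ _ _ _ _; set f' := thresholding_network _ _ _ _ _ _.
have -> : Q1 *m f - Q2 *m f' = Q1 *m (f - f') + (Q1 - Q2) *m f'.
  by rewrite mulmxBr mulmxBl addrA subrK.
rewrite (le_trans (norm2D _ _))// mulrDl lerD//.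
  by rewrite norm2_orthogonal// network_weight_lipschitz.
rewrite (le_trans (norm2_mulmx _ _))// -mulrA mulrCA.
by rewrite ler_wpM2l ?spectral_norm_ge0// norm2_network.
Qed.

Lemma network_loss_signal_lipschitz theta x x' : orthogonal_pair theta ->
  `|network_loss theta x - network_loss theta x'| <=
  (input_gain L * nA + 1) * norm2 (x - x').
Proof.
case: theta => [P Q] [/= oP oQ]; rewrite (le_trans (norm2_dist _ _))//=.
rewrite opprD addrACA (le_trans (norm2D _ _))// mulrDl mul1r.
rewrite lerD//; last by rewrite -opprD norm2N.
rewrite (le_trans (radial_clip_nonexpansive _ _ (ltW Bout_gt0)))//=.
rewrite -mulmxBr norm2_orthogonal// (le_trans (network_input_lipschitz _ _ _ _))//.
by rewrite -mulrA ler_wpM2l ?input_gain_ge0// -mulmxBr norm2_mulmx.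
Qed.

End NetworkEstimates.

(** * Covering numbers *)

Section Covering.
Context {R : realType}.

Lemma le1_of_bounded_powers (x C : R) : (forall J, x ^+ J <= C) -> x <= 1.
Proof.
move=> xC; rewrite leNgt; apply/negP => x1.
have bernoulli J : 1 + J%:R * (x - 1) <= x ^+ J.
  elim: J => [|J IHJ]; first by rewrite mul0r addr0 expr0.
  rewrite exprS (le_trans _ (ler_wpM2l (ltW (lt_trans ltr01 x1)) IHJ))//.
  rewrite -natr1 -subr_ge0.
  have -> : x * (1 + J%:R * (x - 1)) - (1 + (J%:R + 1) * (x - 1)) =
    J%:R * (x - 1) ^+ 2 by ring.
  by rewrite mulr_ge0 ?sqr_ge0.
have h : 0 < x - 1 by rewrite subr_gt0.
have C0 : 0 <= C by rewrite (le_trans _ (xC 0%N)).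
have := truncn_itv (divr_ge0 C0 (ltW h)) => /andP[_]; rewrite ltr_pdivrMr//.
have := le_trans (bernoulli (Num.truncn (C / (x - 1))).+1) (xC _).
by lra.
Qed.

Variables (p q : nat).
Implicit Types (s t : seq 'M[R]_(p, q)).

Definition separated (eps : R) s :=
  pairwise (fun x y => eps <= spectral_norm (x - y)) s.

Definition in_ball (r : R) s := all (fun x => spectral_norm x <= r) s.

(** A crude count, with a constant depending on the dimension: a grid of mesh
    [1 / (p * q).+1] has at most one point of a 1-separated set per cell. *)
Lemma separated_size_crude rho s : 0 <= rho -> in_ball rho s -> separated 1 s ->
  (size s)%:R <= (2 * (p * q).+1%:R * rho + 1) ^+ (p * q).
Proof.
move=> rho0 s_rho s_sep; set K := (p * q).+1; set n := Num.truncn (2 * K%:R * rho).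
have K0 : 0 < K%:R :> R by rewrite ltr0n.
pose cell (x : 'M[R]_(p, q)) : 'M['I_n.+1]_(p, q) :=
  \matrix_(i, j) inord (Num.truncn (K%:R * (x i j + rho))).
have cellP (x : 'M[R]_(p, q)) i j : spectral_norm x <= rho ->
    (cell x i j)%:R <= K%:R * (x i j + rho) < (cell x i j).+1%:R.
  move=> x_rho; have := le_trans (entry_le_spectral_norm x i j) x_rho.
  rewrite ler_norml => /andP[x1 x2]; rewrite mxE inordK.
    by apply: truncn_itv; rewrite mulr_ge0//; lra.
  rewrite ltnS le_truncn// (mulrC 2) -mulrA ler_pM2l//; lra.
have cell_inj x y : x \in s -> y \in s -> cell x = cell y -> spectral_norm (x - y) < 1.
  move=> /(allP s_rho) x_rho /(allP s_rho) y_rho xy.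
  apply: le_lt_trans (spectral_norm_le_frobenius _) _.
  rewrite -sqrtr1 ltr_sqrt// (@le_lt_trans _ _ (\sum_(i < p) \sum_(j < q) K%:R^-1 ^+ 2))//.
    apply: ler_sum => i _; apply: ler_sum => j _.
    rewrite !mxE -real_normK ?num_real// lerXn2r ?nnegrE ?invr_ge0 ?ler0n//.
    have := cellP x i j x_rho; have := cellP y i j y_rho; rewrite xy -natr1.
    move=> /andP[y1 y2] /andP[x1 x2].
    rewrite -[leRHS]mul1r ler_pdivlMr// -[X in _ * X]gtr0_norm// -normrM ler_norml.
    by apply/andP; split; lra.
  rewrite !sumr_const !card_ord -mulrnA mulnC -[X in X < _]mulr_natl exprVn.
  rewrite ltr_pdivrMr ?exprn_gt0// mul1r -natrX ltr_nat /K.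
  by rewrite expnS expn1 (@leq_trans (p * q).+1)// leq_pmulr.
have uniq_cells : uniq (map cell s).
  rewrite uniq_pairwise pairwise_map.
  apply: (@sub_in_pairwise _ [in s] _ _ _ s _ s_sep); last exact/allP.
  move=> x y xs ys /= sep; apply/eqP => /(cell_inj x y xs ys).
  by rewrite ltNge sep.
have : (size s <= n.+1 ^ (p * q))%N.
  by rewrite -(size_map cell) -(card_uniqP uniq_cells) -[X in (X ^ _)%N]card_ord -card_mx max_card.
rewrite -(ler_nat R) => /le_trans; apply; rewrite natrX lerXn2r ?nnegrE//.
  by rewrite addr_ge0// mulr_ge0// mulr_ge0 ?ltW.
have Krho0 : 0 <= 2 * K%:R * rho by rewrite mulr_ge0// mulr_ge0// ltW.
by rewrite -natr1 lerD2r; case/andP: (truncn_itv Krho0).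
Qed.

(** Placing a copy of a packing of a small ball around each point of a
    magnified packing gives a packing of a larger ball. *)
Lemma separated_product eps r rho s t : 0 < eps -> 0 <= rho ->
  in_ball r s -> separated eps s -> in_ball rho t -> separated 1 t ->
  let u := [seq ((2 * rho + 1) / eps) *: x + y | x <- s, y <- t] in
  in_ball ((2 * rho + 1) / eps * r + rho) u /\ separated 1 u.
Proof.
move=> eps0 rho0 s_r s_sep t_rho t_sep; set c := (2 * rho + 1) / eps => u.
have c0 : 0 < c by rewrite divr_gt0// ltr_wpDl// mulr_ge0.
split.
  apply/allP => _ /allpairsP[[x y]] /= [xs yt ->].
  rewrite (le_trans (spectral_normD _ _))// lerD ?(allP t_rho)// spectral_normZ gtr0_norm//.
  by rewrite ler_pM2l// (allP s_r).
rewrite {}/u /separated; elim: s s_r s_sep => // x s IHs /andP[x_r s_r] /andP[/allP x_s s_sep].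
rewrite allpairs_cons pairwise_cat IHs// andbT; apply/andP; split; last first.
  rewrite pairwise_map; apply: sub_pairwise t_sep => y y' /=.
  by rewrite opprD addrACA subrr add0r.
apply/allrelP => _ _ /mapP[y yt ->] /allpairsP[[x' y']] /= [x's y't ->].
have := x_s _ x's; rewrite -(ler_pM2l c0) {1}/c divfK ?gt_eqF// => sep.
have := allP t_rho _ yt; have := allP t_rho _ y't.
have -> : c *: x + y - (c *: x' + y') = c *: (x - x') + (y - y').
  by rewrite scalerBr opprD addrACA.
have := spectral_normD (c *: (x - x') + (y - y')) (- (y - y')).
have := spectral_normD y (- y').
rewrite addrK !spectral_normN spectral_normZ gtr0_norm//.
move: sep; lra.
Qed.

(** The volumetric bound on packings, with its sharp constant. Iterating
    [separated_product] yields [size s ^ J] points in a ball of radius less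
    than [(1 + 2 * r / eps) ^ J]; the dimension-dependent constant of the crude
    count disappears as [J] grows. *)
Lemma separated_size eps r s : 0 < eps -> 0 <= r ->
  in_ball r s -> separated eps s ->
  (size s)%:R <= (1 + 2 * r / eps) ^+ (p * q).
Proof.
move=> eps0 r0 s_r s_sep; set theta := 1 + _; set K := (p * q).+1.
have theta1 : 1 <= theta by rewrite lerDl divr_ge0 ?mulr_ge0// ltW.
have rhoJ J : 0 <= (theta ^+ J - 1) / 2 by rewrite divr_ge0// subr_ge0 exprn_ege1.
have iter J : exists t, [/\ size t = (size s ^ J)%N, in_ball ((theta ^+ J - 1) / 2) t
    & separated 1 t].
  elim: J => [|J [t [t_size t_rho t_sep]]].
    exists [:: 0]; split=> //; rewrite /in_ball /= expr0 subrr mul0r andbT.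
    by rewrite -(scale0r 0) spectral_normZ normr0 mul0r.
  have [u_ball u_sep] := separated_product eps0 (rhoJ J) s_r s_sep t_rho t_sep.
  eexists; split; [|apply: sub_all u_ball|exact: u_sep].
    by rewrite size_allpairs t_size expnS.
  move=> x /le_trans; apply; rewrite le_eqVlt; apply/orP; left; apply/eqP.
  rewrite exprSr [in RHS]mulrDr; move: (theta ^+ J) => u; field; lra.
have theta0 : 0 < theta ^+ (p * q) by rewrite exprn_gt0// (lt_le_trans ltr01).
rewrite -[leRHS]mul1r -ler_pdivrMr//.
apply: (@le1_of_bounded_powers _ (K%:R ^+ (p * q))) => J.
have [t [t_size t_rho t_sep]] := iter J.
have := separated_size_crude (rhoJ J) t_rho t_sep; rewrite t_size natrX => /le_trans h.
rewrite expr_div_n ler_pdivrMr; last by rewrite exprn_gt0.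
rewrite h// exprAC -exprMn lerXn2r ?nnegrE//.
- by rewrite addr_ge0// mulr_ge0.
- by rewrite mulr_ge0// exprn_ge0// (le_trans ler01).
rewrite -/K; have : 1 <= K%:R :> R by rewrite ler1n.
lra.
Qed.

(** A maximal packing is a net; the scale [c] may vanish, and then one point
    suffices. *)
Lemma finite_net (T : eqType) (S : set T) (F : T -> 'M[R]_(p, q)) (c r eps : R) :
  0 <= c -> 0 <= r -> 0 < eps -> S !=set0 ->
  (forall x, S x -> spectral_norm (F x) <= r) ->
  exists s : seq T, [/\ forall x, x \in s -> S x,
    (size s)%:R <= (1 + 2 * c * r / eps) ^+ (p * q) &
    forall x, S x -> exists2 y, y \in s & c * spectral_norm (F x - F y) <= eps].
Proof.
move=> c0 r0 eps0 [x0 Sx0] S_r.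
have [->|c_neq0] := eqVneq c 0.
  exists [:: x0]; split=> [x|/=|x Sx]; first by rewrite inE => /eqP ->.
    by rewrite mulr0 !mul0r addr0 expr1n.
  by exists x0; rewrite ?mem_head// mul0r ltW.
have {c_neq0}c0 : 0 < c by rewrite lt_def c_neq0.
have epsc : 0 < eps / c by rewrite divr_gt0.
pose packing (s : seq T) := (forall x, x \in s -> S x) /\ separated (eps / c) (map F s).
pose P k := `[< exists2 s : seq T, size s = k & packing s >].
have size_packing (s : seq T) : packing s -> (size s)%:R <= (1 + 2 * c * r / eps) ^+ (p * q).
  move=> [sS s_sep]; rewrite -(size_map F).
  have -> : 2 * c * r / eps = 2 * r / (eps / c) by field; lra.
  apply: separated_size => //; rewrite /in_ball all_map; apply/allP => x /sS; exact: S_r.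
have P0 : exists k, P k by exists 0%N; apply/asboolP; exists [::].
have Pub k : P k -> (k <= Num.truncn ((1 + 2 * c * r / eps) ^+ (p * q)))%N.
  move=> /asboolP[s <- /size_packing]; rewrite truncn_ge_nat//.
  by rewrite exprn_ge0// addr_ge0// divr_ge0 ?(ltW eps0)// !mulr_ge0// ltW.
case: (ex_maxnP P0 Pub) => _ /asboolP[s <- s_pack] s_max.
exists s; split; [by case: s_pack|exact: size_packing|move=> x Sx].
apply: contrapT => nx; have : P (size (x :: s)).
  apply/asboolP; exists (x :: s) => //; case: s_pack => sS s_sep; split.
    by move=> y; rewrite inE => /predU1P[->//|/sS].
  rewrite /separated /= -/(separated _ _) s_sep andbT all_map; apply/allP => y ys /=.
  rewrite leNgt; apply/negP => xy; apply: nx; exists y => //.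
  by rewrite mulrC -ler_pdivlMr// ltW.
by move=> /s_max; rewrite ltnn.
Qed.

End Covering.

(** * Concentration and symmetrization over finite sample spaces *)

Section Cosh.
Context {R : realType}.

Lemma pow2_fact_le n : (2 ^ n * n`! <= (n.*2)`!)%N.
Proof.
elim: n => // n IHn; rewrite doubleS !factS expnS.
rewrite (_ : 2 * 2 ^ n * (n.+1 * n`!) = n.+1.*2 * (2 ^ n * n`!))%N; last first.
  by rewrite -muln2; ring.
rewrite doubleS leq_pmul2l// (leq_trans IHn)//.
by rewrite leq_pmull.
Qed.

(** Comparison of Taylor coefficients: [2 ^ n * n! <= (2 n)!]. *)
Lemma cosh_le (x : R) : expR x + expR (- x) <= 2 * expR (x ^+ 2 / 2).
Proof.
set y := x ^+ 2 / 2; have y0 : 0 <= y by rewrite divr_ge0 ?sqr_ge0.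
have cv z := @is_cvg_series_exp_coeff R z.
rewrite /expR -limD; [|exact: cv|exact: cv].
apply: limr_le; first by apply: is_cvgD; exact: cv.
apply: nearW => N; rewrite -/(expR y).
have even n : series (exp_coeff x) n.*2 + series (exp_coeff (- x)) n.*2
    <= 2 * series (exp_coeff y) n /\
  series (exp_coeff x) n.*2.+1 + series (exp_coeff (- x)) n.*2.+1
    <= 2 * series (exp_coeff y) n.+1.
  have odd_step k : series (exp_coeff x) k.*2 + series (exp_coeff (- x)) k.*2
      <= 2 * series (exp_coeff y) k ->
      series (exp_coeff x) k.*2.+1 + series (exp_coeff (- x)) k.*2.+1
      <= 2 * series (exp_coeff y) k.+1.
    move=> IH; rewrite /series /= !big_nat_recr//=.
    rewrite addrACA mulrDr; apply: lerD; first exact: IH.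
    have -> : exp_coeff (- x) k.*2 = exp_coeff x k.*2.
      by rewrite /exp_coeff /= -muln2 mulnC !exprM sqrrN.
    suff : exp_coeff x k.*2 <= exp_coeff y k by move: (exp_coeff _ _) => u; lra.
    rewrite /exp_coeff /= -mul2n exprM /y [(_ / 2) ^+ k]exprMn.
    rewrite -mulrA ler_wpM2l//; first by rewrite exprn_ge0// sqr_ge0.
    rewrite exprVn -invfM.
    rewrite lef_pV2 ?posrE ?mulr_gt0 ?exprn_gt0 ?ltr0n ?fact_gt0//.
    by rewrite -natrX -natrM ler_nat mul2n pow2_fact_le.
  elim: n => [|n [IHe IHo]].
    by split; [rewrite /series /= !big_geq// addr0 mulr0|apply: odd_step;
      rewrite /series /= !big_geq// addr0 mulr0].
  have e : series (exp_coeff x) n.+1.*2 + series (exp_coeff (- x)) n.+1.*2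
      <= 2 * series (exp_coeff y) n.+1.
    rewrite doubleS; apply: le_trans IHo; rewrite /series /= [in leLHS]big_nat_recr//=.
    rewrite [X in _ + X <= _]big_nat_recr//= addrACA gerDl /exp_coeff /= exprNn.
    by rewrite -signr_odd /= odd_double expr1 mulN1r mulNr subrr.
  by split; [|exact: odd_step].
have le_exp n : 2 * series (exp_coeff y) n <= 2 * expR y.
  rewrite ler_pM2l//; apply: nondecreasing_cvgn_le; last exact: cv.
  by apply: nondecreasing_series => k _ _; rewrite exp_coeff_ge0.
rewrite /= -(odd_double_half N); case: (even N./2) => h1 h2.
by case: (odd N); rewrite ?add1n ?add0n; [apply: le_trans h2 _|apply: le_trans h1 _].
Qed.

End Cosh.

Section IidMean.
Context {R : realType}.

Definition finite_law (T : finType) (p : T -> R) : Prop :=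
  (forall t, 0 <= p t) /\ \sum_t p t = 1.

(** The mean of [G] over [m] independent samples of law [p]. The recursion on
    [m] makes the one-sample-at-a-time arguments below plain inductions. *)
Fixpoint iid_mean (T : finType) (p : T -> R) (m : nat) (G : seq T -> R) : R :=
  if m is k.+1 then \sum_t p t * iid_mean p k (fun s => G (t :: s)) else G [::].

Section Basics.
Variables (T : finType) (p : T -> R).
Hypothesis p_law : finite_law p.

Lemma law_ge0 t : 0 <= p t. Proof. by case: p_law. Qed.

Lemma law_sum_cst c : \sum_t p t * c = c.
Proof. by rewrite -mulr_suml; case: p_law => _ ->; rewrite mul1r. Qed.

Lemma iid_mean_le m G H : (forall s, size s = m -> G s <= H s) ->
  iid_mean p m G <= iid_mean p m H.
Proof.
elim: m G H => [|m IHm] G H GH /=; first exact: GH.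
apply: ler_sum => t _; rewrite ler_wpM2l ?law_ge0// IHm// => s sm.
by rewrite GH//= sm.
Qed.

Lemma eq_iid_mean m G H : (forall s, size s = m -> G s = H s) ->
  iid_mean p m G = iid_mean p m H.
Proof. by move=> GH; apply/eqP; rewrite eq_le !iid_mean_le// => s /GH ->. Qed.

Lemma iid_meanD m G H :
  iid_mean p m (fun s => G s + H s) = iid_mean p m G + iid_mean p m H.
Proof.
elim: m G H => //= m IHm G H; rewrite -big_split /=.
by apply: eq_bigr => t _; rewrite IHm mulrDr.
Qed.

Lemma iid_meanZ m c G : iid_mean p m (fun s => c * G s) = c * iid_mean p m G.
Proof.
elim: m G => //= m IHm G; rewrite mulr_sumr.
by apply: eq_bigr => t _; rewrite IHm mulrCA.
Qed.

Lemma iid_meanB m G H :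
  iid_mean p m (fun s => G s - H s) = iid_mean p m G - iid_mean p m H.
Proof.
rewrite -[- iid_mean p m H]mulN1r -iid_meanZ -iid_meanD.
by apply: eq_iid_mean => s _; rewrite mulN1r.
Qed.

Lemma iid_mean_cst m c : iid_mean p m (fun=> c) = c.
Proof. by elim: m => //= m ->; exact: law_sum_cst. Qed.

Lemma iid_mean_sum (I : Type) (r : seq I) m (G : I -> seq T -> R) :
  iid_mean p m (fun s => \sum_(i <- r) G i s) = \sum_(i <- r) iid_mean p m (G i).
Proof.
elim: r => [|i r IHr].
  by rewrite big_nil -[RHS](iid_mean_cst m); apply: eq_iid_mean => s _; rewrite big_nil.
rewrite big_cons -IHr -iid_meanD.
by apply: eq_iid_mean => s _; rewrite big_cons.
Qed.

Lemma jensen_expR (f : T -> R) : expR (\sum_t p t * f t) <= \sum_t p t * expR (f t).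
Proof.
set mu := \sum_t _.
have -> : expR mu = \sum_t p t * (expR mu * (1 + (f t - mu))).
  transitivity (expR mu * \sum_t (p t * (1 - mu) + p t * f t)); last first.
    by rewrite mulr_sumr; apply: eq_bigr => t _; ring.
  by rewrite big_split /= law_sum_cst -/mu subrK mulr1.
apply: ler_sum => t _; rewrite ler_wpM2l ?law_ge0//.
have -> : expR (f t) = expR mu * expR (f t - mu) by rewrite -expRD addrC subrK.
by rewrite ler_wpM2l ?expR_ge0 ?expR_ge1Dx.
Qed.

(** Hoeffding's lemma with the constant given by comparing a sample with an
    independent copy of itself, whose difference is symmetric. *)
Lemma hoeffding_mgf (g : T -> R) (c s : R) : (forall t t', `|g t - g t'| <= c) ->
  \sum_t p t * expR (s * g t) <= expR (s * \sum_t p t * g t + s ^+ 2 * c ^+ 2 / 2).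
Proof.
move=> gc; set mu := \sum_t p t * g t; set B := expR (s ^+ 2 * c ^+ 2 / 2).
have two : 2 * (\sum_t p t * \sum_t' p t' * expR (s * (g t - g t'))) <= 2 * B.
  have -> : 2 * (\sum_t p t * \sum_t' p t' * expR (s * (g t - g t'))) =
      \sum_t p t * \sum_t' p t' *
        (expR (s * (g t - g t')) + expR (- (s * (g t - g t')))).
    under [RHS]eq_bigr => t _ do under eq_bigr => t' _ do rewrite mulrDr.
    under [RHS]eq_bigr => t _ do rewrite big_split /= mulrDr.
    rewrite big_split /= mulrDl !mul1r; congr (_ + _).
    under eq_bigr => t _ do rewrite mulr_sumr.
    under [RHS]eq_bigr => t _ do rewrite mulr_sumr.
    rewrite exchange_big /=; apply: eq_bigr => t _; apply: eq_bigr => t' _.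
    by rewrite -mulrN opprB mulrCA.
  rewrite -[leRHS]law_sum_cst; apply: ler_sum => t _; rewrite ler_wpM2l ?law_ge0//.
  rewrite -[leRHS]law_sum_cst; apply: ler_sum => t' _; rewrite ler_wpM2l ?law_ge0//.
  rewrite (le_trans (cosh_le _))// ler_pM2l// ler_expR ler_pM2r ?invr_gt0//.
  rewrite exprMn ler_wpM2l ?sqr_ge0// -real_normK ?num_real// lerXn2r ?nnegrE//.
  exact: le_trans (gc t t').
have jen : expR (- (s * mu)) <= \sum_t p t * expR (- (s * g t)).
  have -> : - (s * mu) = \sum_t p t * - (s * g t).
    by rewrite /mu mulr_sumr -sumrN; apply: eq_bigr => t _; ring.
  exact: jensen_expR.
rewrite expRD -/B -ler_pdivrMl ?expR_gt0// -expRN.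
rewrite -(@ler_pM2l _ 2)//; apply: le_trans two; rewrite ler_pM2l//.
have S0 : 0 <= \sum_t p t * expR (s * g t).
  by apply: sumr_ge0 => t _; rewrite mulr_ge0 ?law_ge0 ?expR_ge0.
apply: (le_trans (ler_wpM2r S0 jen)); rewrite mulrC mulr_suml le_eqVlt.
apply/orP; left; apply/eqP; apply: eq_bigr => t _.
rewrite -mulrA; congr (_ * _); rewrite mulr_sumr; apply: eq_bigr => t' _.
by rewrite mulrCA -expRD mulrBr.
Qed.

(** McDiarmid's inequality, at the level of moment generating functions. The
    mean over the remaining samples inherits the bounded differences of [G], so
    Hoeffding's lemma applies to one sample at a time. *)
Lemma mcdiarmid_mgf m (G : seq T -> R) (c s : R) :
  (forall u v t t', size (u ++ t :: v) = m ->
     `|G (u ++ t :: v) - G (u ++ t' :: v)| <= c) ->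
  iid_mean p m (fun u => expR (s * G u)) <=
  expR (s * iid_mean p m G + m%:R * (s ^+ 2 * c ^+ 2 / 2)).
Proof.
elim: m G => [|m IHm] G Gc /=; first by rewrite mul0r addr0.
apply: (@le_trans _ _ (\sum_t p t *
   expR (s * iid_mean p m (fun u => G (t :: u)) + m%:R * (s ^+ 2 * c ^+ 2 / 2)))).
  apply: ler_sum => t _; rewrite ler_wpM2l ?law_ge0// IHm// => u v t1 t2 um.
  by apply: (Gc (t :: u)); rewrite /= um.
rewrite -[m.+1%:R]natr1 mulrDl mul1r addrCA expRD.
have := @hoeffding_mgf (fun t => iid_mean p m (fun u => G (t :: u))) c s.
move=> /(_ _)/(ler_wpM2l (expR_ge0 (m%:R * (s ^+ 2 * c ^+ 2 / 2)))) h.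
apply: le_trans (h _); last first.
  move=> t t'; rewrite -iid_meanB ler_norml -[c](iid_mean_cst m).
  rewrite -mulN1r -iid_meanZ; apply/andP; split; apply: iid_mean_le => u um.
    by have := Gc [::] u t t'; rewrite /= um => /(_ erefl); rewrite ler_norml mulN1r => /andP[].
  by have := Gc [::] u t t'; rewrite /= um => /(_ erefl); rewrite ler_norml => /andP[].
rewrite mulr_sumr le_eqVlt; apply/orP; left; apply/eqP.
by apply: eq_bigr => t _; rewrite expRD; ring.
Qed.

(** Chernoff's bound for [mcdiarmid_mgf]. The classical deviation is half of
    this one; the factor 2 comes from [hoeffding_mgf]. *)
Lemma mcdiarmid_tail m (G : seq T -> R) (c delta : R) :
  (0 < m)%N -> 0 < c -> 0 < delta -> delta < 1 ->
  (forall u v t t', size (u ++ t :: v) = m ->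
     `|G (u ++ t :: v) - G (u ++ t' :: v)| <= c) ->
  iid_mean p m G <= 0 ->
  iid_mean p m (fun u => (c * Num.sqrt (2 * m%:R * ln (delta^-1)) < G u)%R%:R) <= delta.
Proof.
move=> m0 c0 d0 d1 Gc EG; set l := ln _; set t := c * _.
have m0' : 0 < m%:R :> R by rewrite ltr0n.
have l0 : 0 < l by rewrite ln_gt0// invf_gt1.
have r0 : 0 < Num.sqrt (2 * m%:R * l) by rewrite sqrtr_gt0 !mulr_gt0.
have r2 : Num.sqrt (2 * m%:R * l) ^+ 2 = 2 * m%:R * l.
  by rewrite sqr_sqrtr// ltW// !mulr_gt0.
(* The minimiser of the exponent in Chernoff's bound. *)
set s := Num.sqrt (2 * m%:R * l) / (m%:R * c).
have s0 : 0 < s by rewrite divr_gt0// mulr_gt0.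
apply: (@le_trans _ _ (iid_mean p m (fun u => expR (- (s * t)) * expR (s * G u)))).
  apply: iid_mean_le => u _; rewrite -expRD; case: ltP => /= tG; last exact: expR_ge0.
  by rewrite -expR0 ler_expR addrC subr_ge0 ler_pM2l// ltW.
rewrite iid_meanZ; apply: (le_trans (ler_wpM2l (expR_ge0 _) (mcdiarmid_mgf s Gc))).
have -> : delta = expR (- l) by rewrite expRN /l lnK ?invrK// posrE invr_gt0.
rewrite -expRD ler_expR.
have sG : s * iid_mean p m G <= 0 by rewrite mulr_ge0_le0// ltW.
have -> : s * t = 2 * l.
  transitivity (Num.sqrt (2 * m%:R * l) ^+ 2 / m%:R).
    by rewrite /s /t; field; rewrite !gt_eqF.
  by rewrite r2; field; rewrite gt_eqF.
have -> : m%:R * (s ^+ 2 * c ^+ 2 / 2) = l.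
  rewrite /s expr_div_n r2; field.
  by rewrite !gt_eqF.
by rewrite -/l; lra.
Qed.

End Basics.
End IidMean.

Section Symmetrization.
Context {R : realType}.

Definition coin (_ : bool) : R := 2^-1.

Lemma coin_law : finite_law coin.
Proof. by split=> [b|]; [rewrite invr_ge0|rewrite big_bool /coin /=; lra]. Qed.

Definition rademacher_sum (X : Type) (f : X -> R) (e : seq bool) (xs : seq X) : R :=
  \sum_(z <- zip e xs) (-1) ^+ z.1 * f z.2.

Lemma rademacher_sum_cons X (f : X -> R) b e x xs :
  rademacher_sum f (b :: e) (x :: xs) = (-1) ^+ b * f x + rademacher_sum f e xs.
Proof. by rewrite /rademacher_sum /= big_cons. Qed.

Variables (I : finType) (i0 : I).

Definition fmax (a : I -> R) : R := \big[Num.max/a i0]_i a i.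

Lemma fmax_ge a i : a i <= fmax a. Proof. exact: le_bigmax. Qed.

Lemma fmax_le a c : (forall i, a i <= c) -> fmax a <= c.
Proof. by move=> ac; apply: bigmax_le. Qed.

Variables (T : finType).
Implicit Types (V : I -> T -> R) (a b : I -> R).

(** The mean over the signs of the largest Rademacher sum, for sums that start
    at [a]. The offset keeps track of the samples already read, which lets one
    argue by induction on the samples. *)
Definition signed_max V a (u : seq T) : R :=
  iid_mean coin (size u) (fun e => fmax (fun i => a i + rademacher_sum (V i) e u)).

Lemma signed_max_cons V a t u : signed_max V a (t :: u) =
  2^-1 * (signed_max V (fun i => a i - V i t) u + signed_max V (fun i => a i + V i t) u).
Proof.
rewrite /signed_max /= big_bool /= /coin -mulrDr; congr (_ * (_ + _)).
  apply: eq_iid_mean => [|e _]; first exact: coin_law.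
  congr (fmax _); apply/funext => i.
  by rewrite rademacher_sum_cons addrA expr1 mulN1r.
apply: eq_iid_mean => [|e _]; first exact: coin_law.
congr (fmax _); apply/funext => i.
by rewrite rademacher_sum_cons addrA expr0 mul1r.
Qed.

Lemma signed_max_jensen (T' : finType) (p' : T' -> R) V a (b : T' -> I -> R) u :
  finite_law p' -> (forall i, a i <= \sum_t p' t * b t i) ->
  signed_max V a u <= \sum_t p' t * signed_max V (b t) u.
Proof.
move=> p'_law ab; under eq_bigr => t _ do rewrite -(iid_meanZ coin).
rewrite -(iid_mean_sum coin_law); apply: iid_mean_le => [|e _]; first exact: coin_law.
apply: fmax_le => i.
rewrite -[rademacher_sum _ _ _](law_sum_cst p'_law) (le_trans (lerD (ab i) (lexx _)))//.
rewrite -big_split; apply: ler_sum => t _ /=.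
rewrite -mulrDr ler_wpM2l ?(law_ge0 p'_law)//.
exact: (fmax_ge (fun i => b t i + rademacher_sum (V i) e u)).
Qed.

Lemma signed_max_shift V a b c u : (forall i, a i <= b i + c) ->
  signed_max V a u <= signed_max V b u + c.
Proof.
move=> abc; rewrite -(iid_mean_cst coin_law (size u) c) -(iid_meanD coin).
apply: iid_mean_le => [|e _]; first exact: coin_law.
apply: fmax_le => i; rewrite (le_trans (lerD (abc i) (lexx _)))// addrAC lerD2r.
exact: (fmax_ge (fun i => b i + rademacher_sum (V i) e u)).
Qed.

Lemma signed_max_change V a c u v t t' : (forall i, `|V i t - V i t'| <= c) ->
  signed_max V a (u ++ t :: v) <= signed_max V a (u ++ t' :: v) + c.
Proof.
move=> Vc; elim: u a => [|x u IHu] a /=.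
  rewrite !signed_max_cons.
  have h1 : signed_max V (fun i => a i - V i t) v
      <= signed_max V (fun i => a i - V i t') v + c.
    by apply: signed_max_shift => i; have := Vc i; rewrite ler_norml; lra.
  have h2 : signed_max V (fun i => a i + V i t) v
      <= signed_max V (fun i => a i + V i t') v + c.
    by apply: signed_max_shift => i; have := Vc i; rewrite ler_norml; lra.
  by lra.
rewrite !signed_max_cons.
have := IHu (fun i => a i - V i x); have := IHu (fun i => a i + V i x); lra.
Qed.

End Symmetrization.
Section UniformDeviation.
Context {R : realType}.
Variables (I : finType) (i0 : I) (T : finType) (p : T -> R).
Hypothesis p_law : finite_law p.
Variable V : I -> T -> R.

Let mu i := \sum_t p t * V i t.
Let V2 i t := 2 * V i t.

(** Symmetrization, one sample at a time. The function of the offset [a] which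
    the other samples define is convex, so [mu i] may be replaced by an
    independent copy [V i t'] of [V i t]; then [a + V t' - V t] is the midpoint
    of [a + 2 V t'] and [a - 2 V t], and each of these involves one sample
    only. *)
Lemma symmetrization m a :
  iid_mean p m (fun u => fmax i0 (fun i => a i + \sum_(t <- u) (mu i - V i t)))
  <= iid_mean p m (signed_max i0 V2 a).
Proof.
elim: m a => [|m IHm] a /=.
  apply: fmax_le => i; rewrite big_nil.
  apply: le_trans (fmax_ge i0 (fun i => a i + rademacher_sum (V2 i) [::] [::]) i).
  by rewrite /rademacher_sum /= big_nil.
pose Psi b := iid_mean p m (signed_max i0 V2 b).
have jensen (T' : finType) (p' : T' -> R) b (b' : T' -> I -> R) : finite_law p' ->
    (forall i, b i <= \sum_t p' t * b' t i) -> Psi b <= \sum_t p' t * Psi (b' t).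
  move=> p'_law bb'; under eq_bigr => t _ do rewrite -iid_meanZ.
  rewrite -(iid_mean_sum p_law); apply: iid_mean_le => // u _.
  exact: signed_max_jensen.
have first t : iid_mean p m (fun u => fmax i0 (fun i => a i +
      \sum_(t' <- t :: u) (mu i - V i t'))) <= Psi (fun i => a i + (mu i - V i t)).
  apply: le_trans (IHm _); apply: iid_mean_le => // u _; apply: fmax_le => i.
  rewrite big_cons addrA.
  exact: (fmax_ge i0 (fun i => a i + (mu i - V i t) + \sum_(t' <- u) (mu i - V i t'))).
pose A t := Psi (fun i => a i + V2 i t); pose B t := Psi (fun i => a i - V2 i t).
have second t : Psi (fun i => a i + (mu i - V i t)) <=
    \sum_t' p t' * (2^-1 * (A t' + B t)).
  apply: (le_trans (jensen _ _ _ (fun t' i => a i + V i t' - V i t) p_law _)).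
    move=> i; rewrite le_eqVlt; apply/orP; left; apply/eqP.
    under eq_bigr => t' _ do rewrite addrAC mulrDr.
    by rewrite big_split /= (law_sum_cst p_law) -/(mu i); ring.
  apply: ler_sum => t' _; rewrite ler_wpM2l ?(law_ge0 p_law)//.
  apply: (le_trans (jensen _ _ _ (fun (b : bool) i =>
    if b then a i + V2 i t' else a i - V2 i t) coin_law _)).
    by move=> i; rewrite big_bool /coin /V2 /=; lra.
  by rewrite big_bool /coin /= /A /B mulrDr.
apply: (@le_trans _ _ (\sum_t p t * \sum_t' p t' * (2^-1 * (A t' + B t)))).
  apply: ler_sum => t _; rewrite ler_wpM2l ?(law_ge0 p_law)//.
  exact: le_trans (first t) (second t).
have -> : \sum_t p t * \sum_t' p t' * (2^-1 * (A t' + B t)) =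
    \sum_t p t * (2^-1 * (B t + A t)).
  transitivity (\sum_t p t * (\sum_t' p t' * (2^-1 * A t') + 2^-1 * B t)).
    apply: eq_bigr => t _; congr (_ * _).
    under eq_bigr => t' _ do rewrite mulrDr mulrDr.
    by rewrite big_split /= (law_sum_cst p_law).
  under eq_bigr => t _ do rewrite mulrDr.
  rewrite big_split /= (law_sum_cst p_law) -big_split /=.
  by apply: eq_bigr => t _; ring.
rewrite le_eqVlt; apply/orP; left; apply/eqP; apply: eq_bigr => t _.
rewrite /A /B /Psi -iid_meanD -(iid_meanZ p m 2^-1); congr (_ * _).
by apply: eq_iid_mean => // u _; rewrite signed_max_cons.
Qed.

(** Changing one sample moves the largest deviation by at most [c] and the
    symmetrized process by at most [2 * c]. *)
Lemma uniform_deviation m c delta :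
  (0 < m)%N -> 0 < c -> 0 < delta -> delta < 1 ->
  (forall i t t', `|V i t - V i t'| <= c) ->
  iid_mean p m (fun u => (3 * c * Num.sqrt (2 * m%:R * ln (delta^-1)) <
     fmax i0 (fun i => \sum_(t <- u) (mu i - V i t))
     - signed_max i0 V2 (fun=> 0) u)%R%:R) <= delta.
Proof.
move=> m0 c0 d0 d1 Vc.
apply: (@mcdiarmid_tail R T p p_law m (fun u => fmax i0 (fun i => \sum_(t <- u) (mu i - V i t))
     - signed_max i0 V2 (fun=> 0) u)); rewrite ?mulr_gt0//.
- have change u v t t' : fmax i0 (fun i => \sum_(t <- u ++ t :: v) (mu i - V i t)) <=
      fmax i0 (fun i => \sum_(t <- u ++ t' :: v) (mu i - V i t)) + c.
    apply: fmax_le => i.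
    have := fmax_ge i0 (fun i => \sum_(t <- u ++ t' :: v) (mu i - V i t)) i.
    rewrite /= !big_cat !big_cons /=; have := Vc i t t'; rewrite ler_norml; lra.
  have change2 u v t t' := @signed_max_change R I i0 T V2 (fun=> 0) (2 * c) u v t t'.
  have V2c t t' i : `|V2 i t - V2 i t'| <= 2 * c.
    by rewrite /V2 -mulrBr normrM gtr0_norm// ler_pM2l.
  move=> u v t t' _; rewrite ler_norml.
  have := change u v t t'; have := change u v t' t.
  have := change2 u v t t' (V2c t t'); have := change2 u v t' t (V2c t' t).
  by lra.
rewrite (iid_meanB p_law) subr_le0; apply: le_trans (symmetrization m (fun=> 0)).
apply: iid_mean_le => // u _; apply: fmax_le => i.
have := fmax_ge i0 (fun i => 0 + \sum_(t <- u) (mu i - V i t)) i.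
by rewrite add0r.
Qed.

End UniformDeviation.

(** * Chaining *)

Section RademacherSums.
Context {R : realType}.
Variables (X : Type).
Implicit Types (f g : X -> R) (xs : seq X) (e : seq bool).

Lemma rademacher_sumB f g e xs :
  rademacher_sum (fun x => f x - g x) e xs = rademacher_sum f e xs - rademacher_sum g e xs.
Proof. by rewrite /rademacher_sum -sumrB; apply: eq_bigr => z _; rewrite mulrBr. Qed.

Lemma rademacher_sumZ c f e xs :
  rademacher_sum (fun x => c * f x) e xs = c * rademacher_sum f e xs.
Proof. by rewrite /rademacher_sum mulr_sumr; apply: eq_bigr => z _; rewrite mulrCA. Qed.

Lemma rademacher_sum_map (T : Type) (q : X -> T) (f : T -> R) e xs :
  rademacher_sum f e (map q xs) = rademacher_sum (f \o q) e xs.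
Proof.
elim: e xs => [|b e IHe] [|x xs]; rewrite /rademacher_sum ?big_nil//=.
by rewrite !big_cons -!/(rademacher_sum _ _ _) IHe.
Qed.

Lemma rademacher_sum_le f e xs : rademacher_sum f e xs <= \sum_(x <- xs) `|f x|.
Proof.
elim: e xs => [|b e IHe] [|x xs].
- by rewrite /rademacher_sum big_nil big_nil.
- by rewrite /rademacher_sum big_nil sumr_ge0.
- by rewrite /rademacher_sum big_nil big_nil.
rewrite rademacher_sum_cons big_cons lerD//.
by rewrite (le_trans (ler_norm _))// normrM normr_sign mul1r.
Qed.

Lemma sum_norm_le f xs r : 0 < r -> \sum_(x <- xs) f x ^+ 2 <= r ^+ 2 ->
  \sum_(x <- xs) `|f x| <= r * Num.sqrt (size xs)%:R.
Proof.
move=> r0 fr; case: xs fr => [|x0 xs] fr.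
  by rewrite big_nil mulr_ge0 ?sqrtr_ge0// ltW.
set n := size _; set q := Num.sqrt n%:R.
have q0 : 0 < q by rewrite sqrtr_gt0 ltr0n.
have q2 : q ^+ 2 = n%:R by rewrite sqr_sqrtr.
apply: (@le_trans _ _ (\sum_(x <- x0 :: xs) (q / (2 * r) * f x ^+ 2 + r / (2 * q)))).
  apply: ler_sum => x _; rewrite -(real_normK (num_real (f x))).
  move: `|f x| => y; rewrite -subr_ge0.
  have -> : q / (2 * r) * y ^+ 2 + r / (2 * q) - y = (q * y - r) ^+ 2 / (2 * r * q).
    by field; rewrite !gt_eqF.
  by rewrite divr_ge0 ?sqr_ge0// ltW// !mulr_gt0.
rewrite big_split /= -mulr_sumr big_const_seq count_predT iter_addr addr0 -/n.
rewrite -[_ *+ n]mulr_natr -q2.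
have -> : r / (2 * q) * q ^+ 2 = r * q / 2 by field; rewrite gt_eqF.
have : q / (2 * r) * \sum_(x <- x0 :: xs) f x ^+ 2 <= q / (2 * r) * r ^+ 2.
  by rewrite ler_wpM2l// divr_ge0 ?ltW// mulr_gt0.
have -> : q / (2 * r) * r ^+ 2 = r * q / 2 by field; rewrite gt_eqF.
lra.
Qed.

Lemma rademacher_mgf f xs l :
  iid_mean coin (size xs) (fun e => expR (l * rademacher_sum f e xs)) <=
  expR (l ^+ 2 / 2 * \sum_(x <- xs) f x ^+ 2).
Proof.
elim: xs => [|x xs IHxs].
  by rewrite /= /rademacher_sum !big_nil !mulr0.
rewrite big_cons mulrDr expRD /= big_bool /coin /=.
have split b : iid_mean coin (size xs) (fun e => expR (l * rademacher_sum f (b :: e) (x :: xs)))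
    = expR (l * ((-1) ^+ b * f x)) *
      iid_mean coin (size xs) (fun e => expR (l * rademacher_sum f e xs)).
  rewrite -iid_meanZ; apply: eq_iid_mean => [|e _]; first exact: coin_law.
  by rewrite rademacher_sum_cons mulrDr expRD.
rewrite (split true) (split false) (expr1 (-1)) (expr0 (-1)) mulN1r mul1r.
rewrite -[X in X <= _]mulrDr -[X in _ * X]mulrDl [X in X <= _]mulrA mulrN.
apply: ler_pM => //.
- rewrite -(iid_mean_cst coin_law (size xs) 0).
  by apply: iid_mean_le => [|e _]; [exact: coin_law|exact: expR_ge0].
rewrite addrC -ler_pdivlMl ?invr_gt0// invrK (le_trans (cosh_le _))//.
by rewrite exprMn mulrAC.
Qed.

Lemma rademacher_mean f xs :
  iid_mean coin (size xs) (fun e => rademacher_sum f e xs) = 0.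
Proof.
elim: xs => [|x xs IHxs]; first by rewrite /= /rademacher_sum big_nil.
rewrite /= big_bool /coin /=.
have split b : iid_mean coin (size xs) (fun e => rademacher_sum f (b :: e) (x :: xs))
    = (-1) ^+ b * f x.
  under [X in iid_mean _ _ X = _]funext => e do rewrite rademacher_sum_cons.
  by rewrite iid_meanD IHxs addr0 (iid_mean_cst coin_law).
by rewrite !split expr1 expr0; lra.
Qed.

Variable xs : seq X.

(** [b] bounds the mean of the supremum over [S] of the Rademacher sums; an
    envelope [U] stands for the supremum, so that [S] may be infinite. *)
Definition rademacher_bounded (S : set (X -> R)) (b : R) : Prop :=
  exists U : seq bool -> R,
    (forall e f, S f -> rademacher_sum f e xs <= U e) /\
    iid_mean coin (size xs) U <= b.

Definition l2_close (r : R) f g : Prop := \sum_(x <- xs) (f x - g x) ^+ 2 <= r ^+ 2.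

Lemma rademacher_bounded_le S b b' :
  b <= b' -> rademacher_bounded S b -> rademacher_bounded S b'.
Proof. by move=> bb' [U [SU Ub]]; exists U; split=> //; exact: le_trans Ub bb'. Qed.

Lemma rademacher_bounded1 f : rademacher_bounded [set f] 0.
Proof.
by exists (fun e => rademacher_sum f e xs); split=> [e g -> //|]; rewrite rademacher_mean.
Qed.

(** One link of the chain. The maximum of the increments is bounded by
    [ln (sum of exponentials) / l], and [ln y <= y / C - 1 + ln C] makes this
    bound linear, hence easy to average. *)
Lemma rademacher_bounded_link (I : eqType) (F : I -> X -> R) S b (s : seq I) r v :
  0 < r -> 0 < v -> rademacher_bounded S b -> (size s)%:R <= expR v ->
  (forall i, i \in s -> exists2 g, S g & l2_close r (F i) g) ->
  rademacher_bounded (F @` [set` s]) (b + r * Num.sqrt (2 * v)).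
Proof.
move=> r0 v0 [U [SU Ub]] sv near.
have parent i : exists g, i \in s -> S g /\ l2_close r (F i) g.
  have [si|] := boolP (i \in s); last by exists (fun=> 0).
  by have [g Sg Fg] := near _ si; exists g.
have [g gP] := choice parent.
set q := Num.sqrt (2 * v).
have q0 : 0 < q by rewrite sqrtr_gt0 mulr_gt0.
have q2 : q ^+ 2 = 2 * v by rewrite sqr_sqrtr// ltW// mulr_gt0.
(* The choice of [l] balances the two terms of [v / l + l * r ^+ 2 / 2]. *)
set l := q / r; have l0 : 0 < l by rewrite divr_gt0.
have lr : l ^+ 2 / 2 * r ^+ 2 = v.
  by rewrite /l expr_div_n q2; field; rewrite gt_eqF.
pose inc i e := rademacher_sum (fun x => F i x - g i x) e xs.
pose W e := l^-1 * (expR (- (v + v)) * (\sum_(i <- s) expR (l * inc i e)) + (v + v - 1)).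
exists (fun e => U e + W e); split=> [e _ [i /= si <-]|].
  have [Sg _] := gP i si.
  have -> : rademacher_sum (F i) e xs = rademacher_sum (g i) e xs + inc i e.
    by rewrite /inc rademacher_sumB addrC subrK.
  rewrite lerD ?SU// /W -ler_pdivrMl ?invr_gt0// invrK.
  have h : expR (l * inc i e) <= \sum_(i <- s) expR (l * inc i e).
    rewrite (big_rem i)//= lerDl; apply: sumr_ge0 => j _; exact: expR_ge0.
  have := ler_wpM2l (expR_ge0 (- (v + v))) h; rewrite -expRD.
  by have := expR_ge1Dx (- (v + v) + l * inc i e); lra.
rewrite iid_meanD lerD// /W iid_meanZ iid_meanD (iid_mean_cst coin_law) iid_meanZ.
rewrite (iid_mean_sum coin_law).
have mgf : \sum_(i <- s) iid_mean coin (size xs) (fun e => expR (l * inc i e)) <= expR (v + v).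
  rewrite expRD; apply: le_trans (ler_wpM2r (expR_ge0 _) sv).
  have -> : (size s)%:R * expR v = \sum_(i <- s) expR v.
    by rewrite big_const_seq count_predT iter_addr_0 mulr_natl.
  rewrite big_seq [leRHS]big_seq.
  apply: ler_sum => i si; have [_ Fg] := gP i si.
  apply: le_trans (rademacher_mgf _ _ _) _; rewrite ler_expR -[leRHS]lr.
  by rewrite ler_wpM2l// divr_ge0// sqr_ge0.
have := ler_wpM2l (expR_ge0 (- (v + v))) mgf; rewrite -expRD addNr expR0 => {}mgf.
rewrite ler_pdivrMl//; apply: le_trans (lerD mgf (lexx _)) _.
rewrite addrC subrK -mulr2n -mulr_natl -q2 /l le_eqVlt; apply/orP; left; apply/eqP.
by field; rewrite gt_eqF.
Qed.

Lemma rademacher_bounded_remainder S S' b r : 0 < r -> rademacher_bounded S b ->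
  (forall f, S' f -> exists2 g, S g & l2_close r f g) ->
  rademacher_bounded S' (b + r * Num.sqrt (size xs)%:R).
Proof.
move=> r0 [U [SU Ub]] near; exists (fun e => U e + r * Num.sqrt (size xs)%:R).
split=> [e f /near[g Sg fg]|]; last by rewrite iid_meanD (iid_mean_cst coin_law) lerD.
have -> : rademacher_sum f e xs =
    rademacher_sum g e xs + rademacher_sum (fun x => f x - g x) e xs.
  by rewrite rademacher_sumB addrC subrK.
by rewrite lerD ?SU// (le_trans (rademacher_sum_le _ _ _))// sum_norm_le.
Qed.

(** Chaining along nets of radius [D * 2 ^- k] and entropy [v k]; net number
    [k.+1] is linked to net number [k], and the first one to [f0]. *)
Lemma chaining (I : eqType) (F : I -> X -> R) (Theta : set I) (f0 : X -> R)
    (D : R) (v : nat -> R) J :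
  0 < D -> (forall k, 0 < v k) -> (forall i, Theta i -> l2_close D (F i) f0) ->
  (forall k, exists s : seq I, [/\ forall i, i \in s -> Theta i,
     (size s)%:R <= expR (v k) &
     forall i, Theta i -> exists2 j, j \in s & l2_close (D / 2 ^+ k.+1) (F i) (F j)]) ->
  rademacher_bounded (F @` Theta)
    (\sum_(0 <= k < J) D / 2 ^+ k * Num.sqrt (2 * v k)
     + D / 2 ^+ J * Num.sqrt (size xs)%:R).
Proof.
move=> D0 v0 Dball nets.
suff [S [S_bdd S_net]] : exists S : set (X -> R), rademacher_bounded S
    (\sum_(0 <= k < J) D / 2 ^+ k * Num.sqrt (2 * v k)) /\
    forall i, Theta i -> exists2 g, S g & l2_close (D / 2 ^+ J) (F i) g.
  apply: rademacher_bounded_remainder S_bdd _; first by rewrite divr_gt0// exprn_gt0.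
  by move=> _ [i Ti <-]; exact: S_net.
elim: J => [|J [S [S_bdd S_net]]].
  exists [set f0]; rewrite big_geq//; split=> [|i Ti]; first exact: rademacher_bounded1.
  by exists f0 => //; rewrite expr0 divr1; exact: Dball.
have [s [sT s_size s_net]] := nets J.
exists (F @` [set` s]); split; last first.
  by move=> i /s_net[j sj ij]; exists (F j) => //; exists j.
rewrite big_nat_recr//=; apply: rademacher_bounded_link S_bdd _ _ => //.
  by rewrite divr_gt0// exprn_gt0.
by move=> i /sT /S_net.
Qed.

End RademacherSums.

Section EntropySum.
Context {R : realType}.

(** By concavity each square root lies below the tangent at [w], and the
    tangents have a geometric sum. *)
Lemma entropy_sum (w : R) J : 1 <= w ->
  \sum_(0 <= k < J) (2 ^+ k)^-1 * Num.sqrt (w - 2^-1 + k%:R) <= 5 / 2 * Num.sqrt w.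
Proof.
move=> w1; set q := Num.sqrt w.
have q1 : 1 <= q by rewrite -sqrtr1 ler_wsqrtr.
have q2 : q ^+ 2 = w by rewrite sqr_sqrtr// (le_trans ler01).
have q0 : 0 < q by apply: lt_le_trans q1.
have tangent k : Num.sqrt (w - 2^-1 + k%:R) <= q + (k%:R - 2^-1) / (2 * q).
  have rhs : 0 <= q + (k%:R - 2^-1) / (2 * q).
    have -> : q + (k%:R - 2^-1) / (2 * q) = (2 * q ^+ 2 + k%:R - 2^-1) / (2 * q).
      by field; rewrite gt_eqF.
    rewrite divr_ge0 ?mulr_ge0 ?(ltW q0)// q2; have : 0 <= k%:R :> R by []. lra.
  rewrite -(@ler_pXn2r _ 2) ?nnegrE ?sqrtr_ge0// sqr_sqrtr; last first.
    by have : 0 <= k%:R :> R by []; lra.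
  rewrite -subr_ge0.
  have -> : (q + (k%:R - 2^-1) / (2 * q)) ^+ 2 - (w - 2^-1 + k%:R) =
      ((k%:R - 2^-1) / (2 * q)) ^+ 2 by rewrite -q2; field; rewrite gt_eqF.
  exact: sqr_ge0.
have closed : \sum_(0 <= k < J) (2 ^+ k)^-1 * (q + (k%:R - 2^-1) / (2 * q)) =
    2 * q * (1 - (2 ^+ J)^-1) + (1 - (2 * J%:R + 1) / 2 ^+ J) / (2 * q).
  elim: J => [|J IHJ]; first by rewrite big_geq// expr0 mulr0; field; rewrite gt_eqF.
  rewrite big_nat_recr//= IHJ -natr1 exprS; field.
  by rewrite !gt_eqF// exprn_gt0.
apply: (@le_trans _ _ (\sum_(0 <= k < J) (2 ^+ k)^-1 * (q + (k%:R - 2^-1) / (2 * q)))).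
  by apply: ler_sum => k _; rewrite ler_wpM2l ?invr_ge0 ?exprn_ge0.
rewrite closed; have e0 : 0 < (2 ^+ J : R)^-1 by rewrite invr_gt0 exprn_gt0.
have t0 : 0 <= (2 * J%:R + 1) / 2 ^+ J :> R by rewrite divr_ge0 ?exprn_ge0// addr_ge0// mulr_ge0.
have h : (1 - (2 * J%:R + 1) / 2 ^+ J) / (2 * q) <= 2^-1 * q.
  rewrite ler_pdivrMr ?mulr_gt0//; nra.
nra.
Qed.

Lemma sqrtrD_le (x y : R) : 0 <= x -> 0 <= y ->
  Num.sqrt (x + y) <= Num.sqrt x + Num.sqrt y.
Proof.
move=> x0 y0; rewrite -(@ler_pXn2r _ 2) ?nnegrE ?addr_ge0 ?sqrtr_ge0//.
rewrite sqrrD !sqr_sqrtr ?addr_ge0//.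
have : 0 <= Num.sqrt x * Num.sqrt y by rewrite mulr_ge0 ?sqrtr_ge0.
rewrite mulr2n; lra.
Qed.

(** The constant 4 leaves room: the argument gives [5 / 2 * sqrt 2]. *)
Lemma entropy_sum2 (d1 d2 w1 w2 : R) J : 0 <= d1 -> 0 <= d2 -> 1 <= w1 -> 1 <= w2 ->
  \sum_(0 <= k < J) (2 ^+ k)^-1 *
    Num.sqrt (2 * (d1 * (w1 - 2^-1 + k%:R) + d2 * (w2 - 2^-1 + k%:R))) <=
  4 * (Num.sqrt d1 * Num.sqrt w1 + Num.sqrt d2 * Num.sqrt w2).
Proof.
move=> d10 d20 w11 w21.
set z := Num.sqrt (2 : R).
have z2 : z ^+ 2 = 2 by rewrite sqr_sqrtr.
have z0 : 0 <= z by exact: sqrtr_ge0.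
have z8 : z <= 8 / 5 by rewrite -(@ler_pXn2r _ 2) ?nnegrE// z2 ; lra.
apply: (@le_trans _ _ (\sum_(0 <= k < J) (
    z * Num.sqrt d1 * ((2 ^+ k)^-1 * Num.sqrt (w1 - 2^-1 + k%:R)) +
    z * Num.sqrt d2 * ((2 ^+ k)^-1 * Num.sqrt (w2 - 2^-1 + k%:R))))).
  apply: ler_sum => k _; have k0 : 0 <= k%:R :> R by [].
  have a1 : 0 <= w1 - 2^-1 + k%:R by lra.
  have a2 : 0 <= w2 - 2^-1 + k%:R by lra.
  have -> : forall a b c d e f : R, a * b * (c * d) + a * e * (c * f) = c * (a * (b * d + e * f)).
    by move=> *; ring.
  rewrite ler_wpM2l ?invr_ge0 ?exprn_ge0// sqrtrM// -/z ler_wpM2l//.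
  by rewrite -!sqrtrM// sqrtrD_le// mulr_ge0.
rewrite big_split /= -!mulr_sumr.
have h1 := ler_wpM2l (mulr_ge0 z0 (sqrtr_ge0 d1)) (entropy_sum J w11).
have h2 := ler_wpM2l (mulr_ge0 z0 (sqrtr_ge0 d2)) (entropy_sum J w21).
apply: (le_trans (lerD h1 h2)).
have p1 : 0 <= Num.sqrt d1 * Num.sqrt w1 by rewrite mulr_ge0 ?sqrtr_ge0.
have p2 : 0 <= Num.sqrt d2 * Num.sqrt w2 by rewrite mulr_ge0 ?sqrtr_ge0.
have := ler_wpM2r p1 z8; have := ler_wpM2r p2 z8; lra.
Qed.

End EntropySum.

(** * Discretization of the sampling distribution *)

Section Cells.
Context {d : measure_display} {Y : measurableType d} {R : realType}.
Variables (mu : probability Y R) (T : finType) (q : Y -> T).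
Hypothesis mq : forall t, measurable (q @^-1` [set t]).

Lemma cells_bigcup (b : pred T) :
  [set y | b (q y)] = \bigcup_(t in [set t | b t]) (q @^-1` [set t]).
Proof.
by apply/seteqP; split=> [y by_|y [t bt qyt]]; [exists (q y)|rewrite /= qyt].
Qed.

Lemma measurable_cells (b : pred T) : measurable [set y | b (q y)].
Proof.
by rewrite cells_bigcup; apply: fin_bigcup_measurable => // t _; exact: mq.
Qed.

Lemma probability_cells (b : pred T) :
  mu [set y | b (q y)] = (\sum_(t | b t) mu (q @^-1` [set t]))%E.
Proof.
rewrite cells_bigcup measure_fin_bigcup; last 3 first.
- exact: finite_finset.
- exact: trivIset_preimage1.
- by move=> t _; exact: mq.
have -> : [set t | b t] = [set` enum b].
  by apply/seteqP; split=> t /=; rewrite mem_enum.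
by rewrite -fsbig_seq ?enum_uniq// big_enum_cond/=; apply: eq_bigl => t; rewrite andbT.
Qed.

Definition cell_law (t : T) : R := fine (mu (q @^-1` [set t])).

Lemma cell_lawE t : mu (q @^-1` [set t]) = (cell_law t)%:E.
Proof. by rewrite /cell_law fineK// fin_num_measure. Qed.

Lemma cell_law_finite_law : finite_law cell_law.
Proof.
split=> [t|]; first by rewrite fine_ge0.
apply: EFin_inj; rewrite -sumEFin.
under eq_bigr => t _ do rewrite -cell_lawE.
rewrite -(probability_cells xpredT) -[RHS](@probability_setT _ _ _ mu).
by congr (mu _); apply/seteqP; split.
Qed.

(** A function that is constant on the cells has a finite sum as its mean. *)
Lemma expectation_cells_le (g : Y -> R) (v : T -> R) :
  measurable_fun setT g -> (forall y, 0 <= g y) -> (forall t, 0 <= v t) ->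
  {ae mu, forall y, g y <= v (q y)} ->
  ('E_mu[g] <= (\sum_t cell_law t * v t)%:E)%E.
Proof.
move=> mg g0 v0 gv.
have vE y : v (q y) = \sum_t v t * \1_(q @^-1` [set t]) y.
  rewrite (bigD1 (q y))//= indicE mem_set// mulr1 big1 ?addr0// => t tq.
  by rewrite indicE memNset ?mulr0// => /= qt; rewrite qt eqxx in tq.
have m1 t : measurable_fun setT (fun y => v t * \1_(q @^-1` [set t]) y : R).
  by apply: measurable_funM => //; exact: measurable_indic.
have mv : measurable_fun setT (fun y => v (q y)).
  by rewrite (_ : (fun y => v (q y)) = (fun y => \sum_t v t * \1_(q @^-1` [set t]) y));
    [exact: measurable_sum|apply/funext].
apply: (le_trans (expectation_le mg mv _ _ gv)) => //.
rewrite unlock le_eqVlt; apply/orP; left; apply/eqP.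
under eq_integral => y _ do rewrite vE -sumEFin.
rewrite ge0_integral_sum//; last 2 first.
- by move=> t; apply/measurable_EFinP; exact: m1.
- by move=> t y _; rewrite lee_fin mulr_ge0.
rewrite -sumEFin; apply: eq_bigr => t _.
under eq_integral => y _ do rewrite EFinM.
rewrite ge0_integralZl_EFin//; last by apply/measurable_EFinP; exact: measurable_indic.
by rewrite integral_indic// setIT; have /= -> := cell_lawE t; rewrite -EFinM mulrC.
Qed.

End Cells.

Section DiscretizedSamples.
Context {R : realType}.

Lemma iid_mean_tuple (T : finType) (p : T -> R) m G :
  iid_mean p m G = \sum_(u : m.-tuple T) (\prod_(t <- u) p t) * G u.
Proof.
elim: m G => [|m IHm] G /=.
  rewrite (big_pred1 [tuple]) => [|u]; first by rewrite big_nil mul1r.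
  by apply/esym/eqP; exact: tuple0.
under eq_bigr => t _ do rewrite IHm mulr_sumr.
rewrite pair_big /=.
rewrite [RHS](reindex (fun x : T * m.-tuple T => [tuple of x.1 :: x.2])) /=; last first.
  exists (fun u => (thead u, [tuple of behead u])) => [[t u] _|u _] /=.
    by congr (_, _); apply: val_inj.
  by rewrite -tuple_eta.
by apply: eq_bigr => -[t u] _ /=; rewrite big_cons mulrA.
Qed.

Context {d d' : measure_display} {Om : measurableType d} {Y : measurableType d'}.
Variables (P : probability Om R) (D : probability Y R) (m : nat).
Variable X : 'I_m -> {RV P >-> Y}.
Hypotheses (hind : mutually_independent X) (hid : identically_distributed X D).
Variables (T : finType) (q : Y -> T).
Hypothesis mq : forall t, measurable (q @^-1` [set t]).

Definition sample_cells (w : Om) : m.-tuple T := [tuple q (X i w) | i < m].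

Lemma sample_cells_preimage u : sample_cells @^-1` [set u] =
  \bigcap_(i in [set` [set: 'I_m]%SET]) (X i @^-1` (q @^-1` [set tnth u i])).
Proof.
apply/seteqP; split=> [w /= wu i _ /=|w wu]; first by rewrite -wu tnth_mktuple.
by apply: eq_from_tnth => i; rewrite tnth_mktuple; apply: wu; rewrite /= inE.
Qed.

Lemma measurable_sample i (B : set Y) : measurable B -> measurable (X i @^-1` B).
Proof. by move=> mB; rewrite -[_ @^-1` _]setTI; exact: measurable_funP. Qed.

Lemma measurable_sample_cells u : measurable (sample_cells @^-1` [set u]).
Proof.
rewrite sample_cells_preimage; apply: fin_bigcap_measurable => [|i _].
  exact: finite_finset.
exact: measurable_sample.
Qed.

(** Independence enters here only: the cells of the samples have a product
    law, so the probability of an event about them is a finite sum. *)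
Lemma probability_samples (b : pred (seq T)) :
  P [set w | b (sample_cells w)] =
  (iid_mean (cell_law D q) m (fun u => (b u)%:R))%:E.
Proof.
rewrite (probability_cells P measurable_sample_cells (fun u : m.-tuple T => b u)).
rewrite iid_mean_tuple -sumEFin big_mkcond /=; apply: eq_bigr => u _.
case: (b u); last by rewrite mulr0.
rewrite mulr1 sample_cells_preimage hind; last by move=> i; exact: mq.
rewrite big_tuple -prodEFin.
apply: eq_big => [i|i _]; first by rewrite inE.
by rewrite -cell_lawE//; exact: (hid i (mq _)).
Qed.

End DiscretizedSamples.

Section EuclideanCells.
Context {R : realType}.

Lemma norm2_le_entries N (v : 'cV[R]_N) e : 0 <= e ->
  (forall i, `|v i 0| <= e) -> norm2 v <= N%:R * e.
Proof.
move=> e0 ve; apply: norm2_le; first by rewrite mulr_ge0.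
apply: (@le_trans _ _ (\sum_(i < N) e ^+ 2)).
  apply: ler_sum => i _; rewrite -expr2 -real_normK ?num_real//.
  by rewrite lerXn2r ?nnegrE.
rewrite sumr_const card_ord exprMn -[leLHS]mulr_natl ler_wpM2r ?sqr_ge0//.
by rewrite -natrX ler_nat; case: N {v ve} => // N; rewrite expnS expn1 leq_pmulr.
Qed.

Lemma lipschitz_measurable N (f : 'cV[R]_N -> R) C : 0 <= C ->
  (forall x x', `|f x - f x'| <= C * norm2 (x - x')) ->
  measurable_fun setT (f : borel_cV R N -> R).
Proof.
move=> C0 fC; have cf : continuous f.
  move=> /= x A /= /(nbhs_ballP (f x)) [e /= e0 eA].
  have den : 0 < (C + 1) * (N%:R + 1) by rewrite mulr_gt0// ltr_wpDl.
  apply/nbhs_ballP; exists (e / ((C + 1) * (N%:R + 1))); first by rewrite /= divr_gt0.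
  move=> z [e'0 xz]; apply: eA; apply: le_lt_trans (fC x z) _.
  set dl := e / _ in e'0 xz.
  have : norm2 (x - z) <= N%:R * dl.
    apply: norm2_le_entries; first exact: ltW.
    by move=> i; rewrite !mxE ltW//; exact: xz.
  move=> /(ler_wpM2l C0) /le_lt_trans; apply.
  have -> : e = (C + 1) * (N%:R + 1) * dl by rewrite /dl mulrC divfK// gt_eqF.
  rewrite mulrA ltr_pM2r//; have : 0 <= N%:R :> R by []. nra.
apply: (measurability _ (RGenOpens.measurableE R)) => _ [_ [a [b ->] <-]].
rewrite setTI; apply: sub_sigma_algebra.
by move/continuousP: cf; apply; exact: interval_open.
Qed.

Lemma measurable_norm2_ball N (z : 'cV[R]_N) r :
  measurable ([set x | norm2 (x - z) <= r] : set (borel_cV R N)).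
Proof.
have mf : measurable_fun setT ((fun x => norm2 (x - z)) : borel_cV R N -> R).
  apply: (@lipschitz_measurable _ _ 1) => // x x'.
  by rewrite mul1r (le_trans (norm2_dist _ _))// opprB addrA subrK.
have -> : [set x | norm2 (x - z) <= r] =
    setT `&` ((fun x => norm2 (x - z)) : borel_cV R N -> R) @^-1` `]-oo, r].
  by apply/seteqP; split=> x /=; rewrite in_itv /=; [split|case].
exact: mf.
Qed.

(** A point is sent to the first point of a finite net of the ball that lies
    within [eta]; the extra cell collects the points without such a
    neighbour. *)
Lemma euclidean_cells N (B eta : R) : 0 <= B -> 0 < eta ->
  exists (k : nat) (q : borel_cV R N -> 'I_k) (r : 'I_k -> 'cV[R]_N),
    [/\ forall t, measurable (q @^-1` [set t]),
        forall t, norm2 (r t) <= B &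
        forall x, norm2 x <= B -> norm2 (x - r (q x)) <= eta].
Proof.
move=> B0 eta0.
have [s [sB _ s_net]] : exists s : seq 'cV[R]_N, [/\ forall x, x \in s -> norm2 x <= B,
    (size s)%:R <= (1 + 2 * 1 * B / eta) ^+ (N * 1) &
    forall x : 'cV_N, norm2 x <= B -> exists2 y, y \in s & 1 * spectral_norm (x - y) <= eta].
  apply: (@finite_net _ N 1 'cV[R]_N [set x | norm2 x <= B] id) => //.
    by exists 0; rewrite /= norm20.
  by move=> x /= xB; apply: le_trans (spectral_norm_cV _) _.
pose nearby (x z : 'cV[R]_N) := norm2 (x - z) <= eta.
pose q (x : borel_cV R N) : 'I_(size s).+1 := inord (find (nearby x) s).
exists (size s).+1, q, (fun t => nth 0 s t); split=> [t|t|x xB].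
- have -> : q @^-1` [set t] = [set x | find (nearby x) s = t :> nat].
    have qE x : q x = find (nearby x) s :> nat by rewrite inordK// ltnS find_size.
    apply/seteqP; split=> x /=; first by move=> <-; rewrite qE.
    by move=> xt; apply: val_inj; rewrite /= qE.
  have : forall j, measurable ([set x | find (nearby x) s = j] : set (borel_cV R N)).
    elim: s {sB s_net q t} => [|z s IHs] j /=.
      by have [->|j0] := eqVneq j 0%N;
        [rewrite (_ : [set _ | _] = setT)|rewrite (_ : [set _ | _] = set0)];
        rewrite ?predeqE //= => x; split=> // j0'; rewrite -j0' eqxx in j0.
    have mz := measurable_norm2_ball z eta.
    case: j => [|j].
      rewrite (_ : [set _ | _] = [set x | norm2 (x - z) <= eta])//.
      by apply/seteqP; split=> x /=; rewrite /nearby; case: ifP.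
    rewrite (_ : [set _ | _] =
      ~` [set x | norm2 (x - z) <= eta] `&` [set x | find (nearby x) s = j]).
      by apply: measurableI; [exact: measurableC|exact: IHs].
    apply/seteqP; split=> x /=.
      by case: ifPn => // /negP xz [].
    by move=> [/negP xz <-]; rewrite ifN.
  exact.
- by have [ts|ts] := ltnP t (size s); [apply: sB; exact: mem_nth|rewrite nth_default// norm20].
have [y ys xy] := s_net x xB.
have has_near : has (nearby x) s.
  apply/hasP; exists y => //; rewrite /near.
  by move: xy; rewrite mul1r; exact: le_trans (norm2_le_spectral_norm _).
by rewrite /q inordK ?ltnS ?find_size//; exact: (nth_find 0 has_near).
Qed.

End EuclideanCells.

(** * The Rademacher complexity of the networks *)

Section SignedMaxBound.
Context {R : realType}.

(** A bound for the Rademacher process on actual samples [xs] carries over to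
    their cells, at the cost of the cell-wise oscillation [eps]. *)
Lemma signed_max_le (I : finType) (i0 : I) (T : finType) (X : eqType) (xs : seq X)
    (q : X -> T) (V : I -> T -> R) (F : I -> X -> R) S b eps :
  rademacher_bounded xs S b -> (forall i, S (F i)) ->
  (forall i x, x \in xs -> `|V i (q x) - F i x| <= eps) ->
  signed_max i0 (fun i t => 2 * V i t) (fun=> 0) (map q xs) <=
  2 * b + 2 * ((size xs)%:R * eps).
Proof.
move=> [U [SU Ub]] SF VF; rewrite /signed_max size_map.
apply: (@le_trans _ _ (iid_mean coin (size xs) (fun e => 2 * U e + 2 * ((size xs)%:R * eps)))).
  apply: iid_mean_le => [|e _]; first exact: coin_law.
  apply: fmax_le => i; rewrite add0r.
  have -> : rademacher_sum (fun t => 2 * V i t) e (map q xs) =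
      2 * (rademacher_sum (F i) e xs + rademacher_sum (fun x => V i (q x) - F i x) e xs).
    by rewrite rademacher_sumB addrC subrK rademacher_sumZ rademacher_sum_map.
  rewrite -mulrDr ler_pM2l// lerD ?SU// (le_trans (rademacher_sum_le _ _ _))//.
  have -> : (size xs)%:R * eps = \sum_(x <- xs) eps.
    by rewrite big_const_seq count_predT iter_addr_0 mulr_natl.
  by rewrite big_seq [leRHS]big_seq; apply: ler_sum => x; exact: VF.
by rewrite iid_meanD iid_meanZ (iid_mean_cst coin_law) lerD2r ler_pM2l.
Qed.

End SignedMaxBound.

Section NetworkComplexity.
Context {R : realType}.
Variables (n N : nat) (A : 'M[R]_(n, N)).

(** Only [A *m Phi], an [n * N] matrix, matters for the layers, hence the
    exponent [n * N] for the first factor. *)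
Lemma orthogonal_net (c1 c2 eps : R) : 0 <= c1 -> 0 <= c2 -> 0 < eps ->
  exists s : seq ('M[R]_N * 'M[R]_N), [/\
    forall theta, theta \in s -> orthogonal_pair theta,
    (size s)%:R <= (1 + 4 * c1 * spectral_norm A / eps) ^+ (n * N)
                   * (1 + 4 * c2 / eps) ^+ (N * N) &
    forall theta, orthogonal_pair theta -> exists2 theta', theta' \in s &
      c1 * spectral_norm (A *m theta.1 - A *m theta'.1)
      + c2 * spectral_norm (theta.2 - theta'.2) <= eps].
Proof.
move=> c10 c20 eps0; have eps2 : 0 < eps / 2 by rewrite divr_gt0.
have O1 : @orthogonal_group R N !=set0 by exists 1%:M; rewrite /orthogonal_group /= trmx1 mulmx1.
have [s1 [s1O s1_size s1_net]] := @finite_net R n N 'M[R]_N (@orthogonal_group R N)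
  (fun Phi => A *m Phi) c1 (spectral_norm A) (eps / 2) c10 (spectral_norm_ge0 A) eps2 O1
  (@spectral_norm_weights R n N A).
have [s2 [s2O s2_size s2_net]] := @finite_net R N N 'M[R]_N (@orthogonal_group R N)
  id c2 1 (eps / 2) c20 ler01 eps2 O1 (@spectral_norm_orthogonal R N).
exists [seq (Phi, Psi) | Phi <- s1, Psi <- s2]; split.
- by move=> _ /allpairsP[[Phi Psi] /= [/s1O ? /s2O ? ->]].
- rewrite size_allpairs natrM; apply: ler_pM => //.
    by apply: le_trans s1_size _; rewrite le_eqVlt; apply/orP; left; apply/eqP;
      congr ((1 + _) ^+ _); field; rewrite gt_eqF.
  by apply: le_trans s2_size _; rewrite le_eqVlt; apply/orP; left; apply/eqP;
    congr ((1 + _) ^+ _); field; rewrite gt_eqF.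
move=> [Phi Psi] [/= oPhi oPsi].
have [Phi' s1Phi' dPhi] := s1_net Phi oPhi; have [Psi' s2Psi' dPsi] := s2_net Psi oPsi.
exists (Phi', Psi'); first by apply/allpairsP; exists (Phi', Psi').
by rewrite /=; lra.
Qed.

(** At scale [2 ^- k] the entropy per dimension grows at most linearly in [k].
    With [- 1] in place of [- 2^-1] the bound would still hold, but it could
    vanish at [k = 0], and [rademacher_bounded_link] divides by the entropy. *)
Lemma entropy_bound (beta : R) k : 0 <= beta ->
  1 + 2 ^+ k * beta <= expR (ln (expR 1 * (1 + beta)) - 2^-1 + k%:R).
Proof.
move=> beta0; have b1 : 0 < 1 + beta by rewrite ltr_wpDr.
rewrite expRD expRD lnK ?posrE ?mulr_gt0 ?expR_gt0//.
have e2 : 2 ^+ k <= expR k%:R :> R.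
  by rewrite -[k%:R]mulr1 expRM_natl lerXn2r ?nnegrE ?expR_ge0// expR_ge1Dx.
have e1 : 1 <= expR 1 * expR (- 2^-1) :> R.
  by rewrite -expRD -[leLHS]expR0 ler_expR; lra.
have k1 : 1 <= 2 ^+ k :> R by rewrite exprn_ege1// ler1n.
apply: (@le_trans _ _ (2 ^+ k * (1 + beta))); first by rewrite mulrDr mulr1 lerD2r.
apply: (@le_trans _ _ (expR k%:R * (1 + beta))); first by rewrite ler_wpM2r// ltW.
have -> : expR 1 * (1 + beta) * expR (- 2^-1) * expR k%:R =
  expR 1 * expR (- 2^-1) * (expR k%:R * (1 + beta)) by ring.
by rewrite ler_peMl// mulr_ge0 ?expR_ge0// ltW.
Qed.

Variables (tau lambda Bout : R) (L : nat).
Hypotheses (tau_gt0 : 0 < tau) (lambda_gt0 : 0 < lambda) (Bout_gt0 : 0 < Bout).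
Hypotheses (L_gt0 : (1 <= L)%N) (N_gt0 : (1 <= N)%N).

Let nl := network_loss A tau lambda Bout L.

Lemma frobenius_norm_data m (xs : 'I_m -> 'cV[R]_N) :
  frobenius_norm (data_matrix A xs) ^+ 2 = \sum_j norm2 (A *m xs j) ^+ 2.
Proof.
rewrite /frobenius_norm sqr_sqrtr; last first.
  by apply: sumr_ge0 => i _; apply: sumr_ge0 => j _; exact: sqr_ge0.
rewrite exchange_big /=; apply: eq_bigr => j _; rewrite norm2E.
by apply: eq_bigr => i _; rewrite !mxE expr2.
Qed.

(** The increments of the loss are bounded by those of the network output, so
    the Euclidean geometry of the outputs controls the Rademacher process of
    the losses directly. *)
Lemma network_rademacher_bounded m (xs : 'I_m -> 'cV[R]_N) J : (0 < m)%N ->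
  let Y := data_matrix A xs in
  let D := Num.sqrt m%:R * Bout in
  rademacher_bounded [seq xs j | j <- enum 'I_m] (nl @` @orthogonal_pair R N)
    (4 * D * (Num.sqrt (n * N)%:R * Num.sqrt (ln (expR 1 *
                (1 + 8 * const_K A tau Y L * spectral_norm A / D)))
            + Num.sqrt (N * N)%:R * Num.sqrt (ln (expR 1 *
                (1 + 8 * const_M A tau Y L / D))))
     + D / 2 ^+ J * Num.sqrt m%:R).
Proof.
move=> m0 Y D.
have sm0 : 0 < Num.sqrt m%:R :> R by rewrite sqrtr_gt0 ltr0n.
have sm2 : Num.sqrt m%:R ^+ 2 = m%:R :> R by rewrite sqr_sqrtr.
have D0 : 0 < D by rewrite mulr_gt0.
have Y0 := frobenius_norm_ge0 Y.
have K0 : 0 <= const_K A tau Y L by rewrite const_KE mulr_ge0 ?weight_gain_ge0.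
have M0 : 0 <= const_M A tau Y L by rewrite const_ME mulr_ge0 ?input_gain_ge0.
have nA0 := spectral_norm_ge0 A.
set b1 := 8 * const_K A tau Y L * spectral_norm A / D.
set b2 := 8 * const_M A tau Y L / D.
have b10 : 0 <= b1 by rewrite divr_ge0 ?(ltW D0)// !mulr_ge0.
have b20 : 0 <= b2 by rewrite divr_ge0 ?(ltW D0)// mulr_ge0.
set w1 := ln (expR 1 * (1 + b1)); set w2 := ln (expR 1 * (1 + b2)).
have w_ge1 (b : R) : 0 <= b -> 1 <= ln (expR 1 * (1 + b)).
  move=> b0; rewrite -[leLHS](expRK 1) ler_ln ?posrE ?mulr_gt0 ?expR_gt0 ?ltr_wpDr//.
  by rewrite ler_peMr ?expR_ge0// lerDl.
have w11 : 1 <= w1 by exact: w_ge1.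
have w21 : 1 <= w2 by exact: w_ge1.
pose v (k : nat) : R := (n * N)%:R * (w1 - 2^-1 + k%:R) + (N * N)%:R * (w2 - 2^-1 + k%:R).
have v0 k : 0 < v k.
  have k0 : 0 <= k%:R :> R by [].
  rewrite ltr_wpDl ?mulr_gt0 ?ltr0n ?muln_gt0 ?N_gt0//; last lra.
  by rewrite mulr_ge0//; lra.
pose Xs := [seq xs j | j <- enum 'I_m].
have sumE (f : 'cV[R]_N -> R) : \sum_(x <- Xs) f x = \sum_j f (xs j).
  by rewrite big_map big_enum.
have ball theta : orthogonal_pair theta -> l2_close Xs D (nl theta) (@norm2 R N).
  move=> otheta; rewrite /l2_close sumE exprMn sm2.
  apply: (@le_trans _ _ (\sum_(j < m) Bout ^+ 2)).
    apply: ler_sum => j _; rewrite -real_normK ?num_real// lerXn2r ?nnegrE ?(ltW Bout_gt0)//.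
    exact: network_loss_near_norm2.
  by rewrite sumr_const card_ord -[leLHS]mulr_natl.
have nets k : exists s : seq ('M[R]_N * 'M[R]_N), [/\
    forall theta, theta \in s -> orthogonal_pair theta, (size s)%:R <= expR (v k) &
    forall theta, orthogonal_pair theta -> exists2 theta', theta' \in s &
      l2_close Xs (D / 2 ^+ k.+1) (nl theta) (nl theta')].
  have eps0 : 0 < D / 2 ^+ k.+1 by rewrite divr_gt0// exprn_gt0.
  have [s [sO s_size s_net]] := orthogonal_net K0 M0 eps0.
  exists s; split=> // [|theta otheta].
    apply: (le_trans s_size).
    have -> : 4 * const_K A tau Y L * spectral_norm A / (D / 2 ^+ k.+1) = 2 ^+ k * b1.
      by rewrite /b1 exprS; field; rewrite !gt_eqF// exprn_gt0.
    have -> : 4 * const_M A tau Y L / (D / 2 ^+ k.+1) = 2 ^+ k * b2.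
      by rewrite /b2 exprS; field; rewrite !gt_eqF// exprn_gt0.
    have pk0 : 0 <= 2 ^+ k :> R by rewrite exprn_ge0.
    rewrite expRD !expRM_natl; apply: ler_pM.
    - by rewrite exprn_ge0// addr_ge0// mulr_ge0.
    - by rewrite exprn_ge0// addr_ge0// mulr_ge0.
    - rewrite lerXn2r ?nnegrE ?expR_ge0 ?entropy_bound//.
      by rewrite addr_ge0// mulr_ge0.
    - rewrite lerXn2r ?nnegrE ?expR_ge0 ?entropy_bound//.
      by rewrite addr_ge0// mulr_ge0.
  have [theta' stheta' d] := s_net theta otheta; exists theta' => //.
  rewrite /l2_close sumE.
  set e := weight_gain A tau L * spectral_norm (A *m theta.1 - A *m theta'.1)
    + input_gain A tau L * spectral_norm (theta.2 - theta'.2).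
  have e0 : 0 <= e.
    by rewrite addr_ge0// mulr_ge0 ?spectral_norm_ge0 ?weight_gain_ge0 ?input_gain_ge0.
  apply: (@le_trans _ _ ((e * frobenius_norm Y) ^+ 2)).
    rewrite exprMn frobenius_norm_data mulr_sumr; apply: ler_sum => j _.
    rewrite -exprMn -real_normK ?num_real// lerXn2r ?nnegrE ?mulr_ge0 ?norm2_ge0//.
    by apply: network_loss_weight_lipschitz => //; exact: sO.
  rewrite lerXn2r ?nnegrE ?(ltW eps0)//; first exact: mulr_ge0.
  by apply: le_trans d; rewrite const_KE const_ME /e; lra.
have := chaining J D0 v0 ball nets; rewrite size_map size_enum_ord.
apply: rademacher_bounded_le; rewrite lerD2r.
have -> : \sum_(0 <= k < J) D / 2 ^+ k * Num.sqrt (2 * v k) =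
    D * \sum_(0 <= k < J) (2 ^+ k)^-1 * Num.sqrt (2 * v k).
  by rewrite mulr_sumr; apply: eq_bigr => k _; rewrite mulrA.
rewrite [4 * D]mulrC -[leRHS]mulrA ler_pM2l//.
exact: entropy_sum2.
Qed.

End NetworkComplexity.
(** * The generalization bound *)

Section Assembly.
Context {R : realType}.

(** On bounded signals the whole class is approximated by finitely many
    networks; the size of this net does not enter the final bound. *)
Lemma uniform_net n N (A : 'M[R]_(n, N)) (tau lambda Bout B eps : R) L :
  0 < tau -> 0 < lambda -> 0 < Bout -> (1 <= L)%N -> 0 <= B -> 0 < eps ->
  exists s : seq ('M[R]_N * 'M[R]_N), (forall theta, theta \in s -> orthogonal_pair theta) /\
    forall theta, orthogonal_pair theta -> exists2 theta', theta' \in s &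
      forall x, norm2 x <= B ->
        `|network_loss A tau lambda Bout L theta x
          - network_loss A tau lambda Bout L theta' x| <= eps.
Proof.
move=> tau0 lambda0 Bout0 L0 B0 eps0.
have AB0 : 0 <= spectral_norm A * B by rewrite mulr_ge0 ?spectral_norm_ge0.
have [s [sO _ s_net]] := orthogonal_net A
  (mulr_ge0 (weight_gain_ge0 A tau0 L) AB0) (mulr_ge0 (input_gain_ge0 A tau0 L) AB0) eps0.
exists s; split=> // theta otheta; have [theta' stheta' d] := s_net theta otheta.
exists theta' => // x xB; apply: le_trans d.
have lip := network_loss_weight_lipschitz A tau0 lambda0 Bout0 L0 x otheta (sO _ stheta').
rewrite (le_trans lip)// !(mulrAC _ (spectral_norm A * B)) -mulrDl ler_wpM2l//.
  by rewrite addr_ge0// mulr_ge0 ?spectral_norm_ge0 ?weight_gain_ge0 ?input_gain_ge0.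
by rewrite (le_trans (norm2_mulmx _ _))// ler_wpM2l ?spectral_norm_ge0.
Qed.

(** Bounded differences [3 * c] give the factor 3 and [ln delta^-1], against
    the factor 4 and [ln (4 / delta)] on the right. *)
Lemma confidence_slack (c delta : R) m : 0 < c -> (0 < m)%N -> 0 < delta -> delta < 1 ->
  3 * c * Num.sqrt (2 * m%:R * ln delta^-1) / m%:R + c * Num.sqrt (2 * ln (4 / delta) / m%:R)
  <= 4 * c * Num.sqrt (2 * ln (4 / delta) / m%:R).
Proof.
move=> c0 m0 d0 d1; have m0' : 0 < m%:R :> R by rewrite ltr0n.
have -> : Num.sqrt (2 * m%:R * ln delta^-1) = m%:R * Num.sqrt (2 * ln delta^-1 / m%:R).
  rewrite -{2}(ger0_norm (ltW m0')) -sqrtr_sqr -sqrtrM ?sqr_ge0//.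
  by congr Num.sqrt; field; rewrite gt_eqF.
have h : Num.sqrt (2 * ln delta^-1 / m%:R) <= Num.sqrt (2 * ln (4 / delta) / m%:R).
  rewrite ler_wsqrtr// ler_pM2r ?invr_gt0// ler_pM2l// ler_ln ?posrE ?invr_gt0 ?divr_gt0//.
  by rewrite ler_peMl ?invr_ge0 ?(ltW d0)// ler1n.
have := ler_wpM2l (ltW c0) h.
have -> : 3 * c * (m%:R * Num.sqrt (2 * ln delta^-1 / m%:R)) / m%:R =
    3 * (c * Num.sqrt (2 * ln delta^-1 / m%:R)) by field; rewrite gt_eqF.
lra.
Qed.

Lemma exists_small_dyadic (x eps : R) : 0 <= x -> 0 < eps -> exists J, x / 2 ^+ J <= eps.
Proof.
move=> x0 eps0; exists (Num.truncn (x / eps)).+1; set J := _.+1.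
have /andP[_] := truncn_itv (divr_ge0 x0 (ltW eps0)).
rewrite -/J ltr_pdivrMr// => xJ; rewrite ler_pdivrMr ?exprn_gt0// mulrC.
apply: le_trans (ltW xJ) _; rewrite ler_wpM2r ?(ltW eps0)//.
by rewrite -natrX ler_nat ltnW// ltn_expl.
Qed.

End Assembly.

Theorem theorem5 (R : realType) (N n m L : nat)
  (hN : (1 <= N)%N) (hn : (1 <= n)%N) (hm : (1 <= m)%N) (hL : (1 <= L)%N)
  (A : 'M[R]_(n, N)) (tau lambda Bin Bout : R)
  (htau : 0 < tau) (hlambda : 0 < lambda) (hBin : 0 < Bin) (hBout : 0 < Bout)
  (d : measure_display) (Om : measurableType d) (P : probability Om R)
  (D : probability (borel_cV R N) R)
  (X : 'I_m -> {RV P >-> borel_cV R N})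
  (hind : mutually_independent X)
  (hid : identically_distributed X D)
  (hbound : forall i : 'I_m,
     {ae P, forall w, norm2 (X i w : 'cV[R]_N) <= Bin})
  (delta : R) (hdelta0 : 0 < delta) (hdelta1 : delta < 1) :
  exists2 E : set Om,
    measurable E /\ ((1 - delta)%:E <= P E)%E &
    forall w : Om, E w ->
    forall h : 'cV[R]_n -> 'cV[R]_N, hypothesis_space A tau lambda Bout L h ->
      let xs : 'I_m -> 'cV[R]_N := fun j => X j w in
      let Y := data_matrix A xs in
      (true_loss A D h <=
       (empirical_loss A xs h
        + 8 * Bout * Num.sqrt (N%:R * n%:R / m%:R)
          * Num.sqrt (ln (expR 1 *
              (1 + 8 * const_K A tau Y L * spectral_norm A
                   / (Num.sqrt m%:R * Bout))))
        + 8 * Bout * (N%:R / Num.sqrt m%:R)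
          * Num.sqrt (ln (expR 1 *
              (1 + 8 * const_M A tau Y L / (Num.sqrt m%:R * Bout))))
        + 4 * (Bin + Bout) * Num.sqrt (2 * ln (4 / delta) / m%:R))%:E)%E.
Proof.
have m0 : 0 < m%:R :> R by rewrite ltr0n.
have c0 : 0 < Bin + Bout by rewrite addr_gt0.
pose nl := network_loss A tau lambda Bout L.
(* Seven errors of size [eps]: two in the true loss, two in the empirical loss,
   two in the Rademacher average and one for the end of the chain. *)
pose slack := (Bin + Bout) * Num.sqrt (2 * ln (4 / delta) / m%:R).
have slack0 : 0 < slack.
  rewrite mulr_gt0// sqrtr_gt0 divr_gt0// mulr_gt0// ln_gt0// ltr_pdivlMr// mul1r.
  by rewrite (lt_trans hdelta1)// ltr1n.
pose eps := slack / 7; have eps0 : 0 < eps by rewrite divr_gt0.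
have [s [sO s_net]] := uniform_net A htau hlambda hBout hL (ltW hBin) eps0.
have O1 : orthogonal_pair (1%:M, 1%:M : 'M[R]_N).
  by split; rewrite /orthogonal_group /= trmx1 mulmx1.
have [theta0 stheta0 _] := s_net _ O1.
have s0 : (0 < size s)%N by case: s stheta0 {sO s_net}.
pose i0 : 'I_(size s) := Ordinal s0.
pose th (i : 'I_(size s)) := nth theta0 s i.
have thO i : orthogonal_pair (th i) by apply: sO; exact: mem_nth.
pose C := input_gain A tau L * spectral_norm A + 1.
have C0 : 0 < C by rewrite ltr_wpDl// mulr_ge0 ?spectral_norm_ge0 ?input_gain_ge0.
have [k [q [r [mq rB qr]]]] := euclidean_cells N (ltW hBin) (divr_gt0 eps0 C0).
have nl_cell theta x : orthogonal_pair theta -> norm2 x <= Bin ->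
    `|nl theta x - nl theta (r (q x))| <= eps.
  move=> otheta /qr xB.
  apply: le_trans (network_loss_signal_lipschitz A htau hlambda L hBout x _ otheta) _.
  by rewrite mulrC -ler_pdivlMr.
pose V (i : 'I_(size s)) (t : 'I_k) := nl (th i) (r t).
have Vc i t t' : `|V i t - V i t'| <= Bin + Bout.
  have V0 u : 0 <= V i u by exact: network_loss_ge0.
  have VB u : V i u <= Bin + Bout.
    by apply: le_trans (network_loss_le A tau lambda L hBout _ _) _; rewrite lerD2r.
  have := V0 t; have := V0 t'; have := VB t; have := VB t'; rewrite ler_norml; lra.
pose p := cell_law D q; have p_law : finite_law p by exact: cell_law_finite_law.
pose mu i := \sum_t p t * V i t.
pose bad (u : seq 'I_k) := 3 * (Bin + Bout) * Num.sqrt (2 * m%:R * ln delta^-1) <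
  fmax i0 (fun i => \sum_(t <- u) (mu i - V i t))
  - signed_max i0 (fun i t => 2 * V i t) (fun=> 0) u.
have badP : (P [set w | bad (sample_cells X q w)] <= delta%:E)%E.
  by rewrite (probability_samples hind hid mq) lee_fin; exact: uniform_deviation.
have m_ball : measurable ([set x | norm2 x <= Bin] : set (borel_cV R N)).
  by have := measurable_norm2_ball (0 : 'cV[R]_N) Bin; under eq_set do rewrite subr0.
pose out (i : 'I_m) := X i @^-1` ~` [set x : borel_cV R N | norm2 (x : 'cV[R]_N) <= Bin].
have m_out i : measurable (out i).
  by apply: measurable_sample; exact: measurableC.
have out0 i : P (out i) = 0%E.
  by apply/(negligibleP P (m_out i)); exact: hbound.
pose Z := \bigcup_(i in [set: 'I_m]) out i.
have mZ : measurable Z by apply: fin_bigcup_measurable => // i _; exact: m_out.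
have PZ : P Z = 0%E.
  apply/(negligibleP P mZ).
  have all_in : {ae P, forall w, forall i, norm2 (X i w : 'cV[R]_N) <= Bin}.
    exact: filter_forall.
  by apply: negligibleS all_in => w' [i _ wi] /(_ i).
have m_bad : measurable [set w | bad (sample_cells X q w)].
  exact: (measurable_cells (measurable_sample_cells X mq) (fun u : m.-tuple _ => bad u)).
exists (~` ([set w | bad (sample_cells X q w)] `|` Z)).
  split; first by apply: measurableC; exact: measurableU.
  rewrite probability_setC; last exact: measurableU.
  rewrite EFinB leeB// (le_trans (measureU2 P m_bad mZ))//.
  by rewrite [X in (_ + X)%E]PZ adde0.
move=> w; rewrite setCU => -[nbad nZ] h [Psi [Phi [oPsi oPhi hE]]].
cbv zeta; set xs := fun j : 'I_m => X j w; set Y := data_matrix A xs.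
have xsB j : norm2 (xs j) <= Bin by apply: contrapT => jB; apply: nZ; exists j.
pose theta := (Phi, Psi); have otheta : orthogonal_pair theta by [].
have nlE x : loss h x (A *m x) = nl theta x by rewrite hE.
have [thi si thi_near] := s_net theta otheta.
have [i thiE] : exists i, th i = thi.
  by move/(nthP theta0): si => [j js <-]; exists (Ordinal js).
rewrite -{}thiE {thi si} in thi_near.
(* Moving a signal to the representative of its cell costs [eps], and so does
   replacing [h] by its neighbour in the net. *)
have true_le : (true_loss A D h <= (mu i + 2 * eps)%:E)%E.
  rewrite /true_loss (_ : (fun x => loss h x (A *m x)) = nl theta); last first.
    by apply/funext.
  have ae_cell : {ae D, forall x, nl theta x <= nl theta (r (q x)) + eps}.
    exists (~` [set x : borel_cV R N | norm2 (x : 'cV[R]_N) <= Bin]); split.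
    - exact: measurableC.
    - by rewrite -(hid (Ordinal hm) _ (measurableC m_ball)); exact: out0.
    - move=> x /= nx xB; apply: nx; have := nl_cell theta x otheta xB.
      by rewrite ler_norml; lra.
  apply: le_trans (expectation_cells_le mq
      (v := fun t => nl theta (r t) + eps) _ _ _ ae_cell) _.
  - apply: (@lipschitz_measurable _ _ _ C); first exact: ltW.
    by move=> x x'; exact: network_loss_signal_lipschitz.
  - by move=> x; exact: network_loss_ge0.
  - by move=> t; rewrite addr_ge0 ?network_loss_ge0 ?(ltW eps0).
  rewrite lee_fin -/p; apply: (@le_trans _ _ (\sum_t p t * (V i t + 2 * eps))).
    apply: ler_sum => t _; rewrite ler_wpM2l ?(law_ge0 p_law)//.
    have := thi_near (r t) (rB t); rewrite ler_norml /V /nl; lra.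
  under eq_bigr => t _ do rewrite mulrDr.
  by rewrite big_split /= (law_sum_cst p_law).
apply: le_trans true_le _; rewrite lee_fin.
pose Xs := [seq xs j | j <- enum 'I_m].
have cellsE : sample_cells X q w = [seq q x | x <- Xs] :> seq _.
  by rewrite /Xs -map_comp -val_ord_tuple.
have [J J_eps] := exists_small_dyadic (mulr_ge0 (ler0n R 2) (ltW hBout)) eps0.
have rad := @network_rademacher_bounded R n N A tau lambda Bout L htau hlambda hBout hL hN
  m xs J hm.
rewrite /= -/Y -/nl in rad.
set sK := Num.sqrt (ln _) in rad *; set sM := Num.sqrt (ln _) in rad *.
set b := (X in rademacher_bounded _ _ X) in rad.
have XsB x : x \in Xs -> norm2 x <= Bin by move=> /mapP[j _ ->].
have sm := @signed_max_le R _ i0 _ _ Xs q V (fun i => nl (th i)) _ _ eps rad.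
have {}sm := sm (fun i => ex_intro2 _ _ (th i) (thO i) erefl) _.
have {}sm : signed_max i0 (fun i t => 2 * V i t) (fun=> 0) [seq q x | x <- Xs] <=
    2 * b + 2 * (m%:R * eps).
  have -> : m%:R = (size Xs)%:R :> R by rewrite size_map size_enum_ord.
  by apply: sm => i' x /XsB xB; rewrite distrC nl_cell.
have dev : m%:R * mu i - \sum_j V i (q (xs j)) <=
    3 * (Bin + Bout) * Num.sqrt (2 * m%:R * ln delta^-1) + (2 * b + 2 * (m%:R * eps)).
  move/negP: nbad; rewrite /bad cellsE -leNgt lerBlDr => nbad.
  apply: le_trans (le_trans nbad (lerD (lexx _) sm)).
  apply: le_trans (fmax_ge i0 (fun i => \sum_(t <- [seq q x | x <- Xs]) (mu i - V i t)) i).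
  by rewrite /Xs 2!big_map big_enum /= sumrB sumr_const card_ord mulr_natl.
have near_sum : \sum_j V i (q (xs j)) <= m%:R * (empirical_loss A xs h + 2 * eps).
  rewrite mulrDr /empirical_loss mulVKf ?gt_eqF//.
  have -> : m%:R * (2 * eps) = \sum_(j < m) (2 * eps).
    by rewrite sumr_const card_ord mulr_natl.
  rewrite -big_split /=; apply: ler_sum => j _; rewrite nlE /V.
  have := nl_cell (th i) (xs j) (thO i) (xsB j); have := thi_near (xs j) (xsB j).
  by rewrite !ler_norml /nl; lra.
have sm0 : 0 < Num.sqrt m%:R :> R by rewrite sqrtr_gt0.
have sm2 : Num.sqrt m%:R ^+ 2 = m%:R :> R by rewrite sqr_sqrtr// ltW.
have E1 : Num.sqrt (N%:R * n%:R / m%:R) = Num.sqrt (n * N)%:R / Num.sqrt m%:R :> R.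
  by rewrite sqrtrM ?mulr_ge0// sqrtrV// -natrM mulnC.
have E2 : Num.sqrt (N * N)%:R = N%:R :> R.
  by rewrite natrM -expr2 sqrtr_sqr ger0_norm.
have bE : 2 * b = m%:R * (8 * Bout * Num.sqrt (N%:R * n%:R / m%:R) * sK
    + 8 * Bout * (N%:R / Num.sqrt m%:R) * sM + 2 * Bout / 2 ^+ J).
  rewrite /b E1 E2; move: sm0 sm2; move: (Num.sqrt m%:R) => z z0 <-; field.
  by rewrite !gt_eqF// exprn_gt0.
have conf := confidence_slack c0 hm hdelta0 hdelta1.
rewrite -/slack -(_ : 7 * eps = slack) in conf; last by rewrite /eps; field.
set T := 3 * _ * _ in dev conf.
have {}dev : m%:R * mu i <= m%:R * (empirical_loss A xs h
    + (8 * Bout * Num.sqrt (N%:R * n%:R / m%:R) * sK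
    + 8 * Bout * (N%:R / Num.sqrt m%:R) * sM + 2 * Bout / 2 ^+ J) + 4 * eps + T / m%:R).
  have -> : forall x y, m%:R * (x + y + 4 * eps + T / m%:R) =
      m%:R * (x + 2 * eps) + (T + (m%:R * y + 2 * (m%:R * eps))).
    by move=> x y; field; rewrite gt_eqF.
  by rewrite -bE; lra.
rewrite ler_pM2l// in dev.
by move: dev conf J_eps; lra.
Qed.
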